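(* Let $(g_i)_{i\ge1}$ be independent random elements of $\mathrm{Br}_3$, each uniformly distributed on $\{\sigma_1,\sigma_2\}$, and let $w_n = g_1 g_2\cdots g_n$. Then for almost every sample path $(w_n)$ the following hold, where roots are counted with multiplicity. (1) $$\liminf_{n\to\infty}\frac{\#\{t\in S^1 : \Delta_{\widehat{w}_n}(t)=0\}}{n} \ge \frac{5-\sqrt5}{4} > \frac23,$$ and moreover $$\liminf_{n\to\infty}\frac{\#\{t\in \overline{\mathcal{A}_L} : \Delta_{\widehat{w}_n}(t)=0\}}{n}\ge\frac{7-3\sqrt5}{12}>0.$$ (2) For any $0\le\theta_1<\theta_2<2\pi/3$, $$\liminf_{n\to\infty}\frac{\#\{t=e^{i\theta} : \theta\in[\theta_1,\theta_2],\ \Delta_{\widehat{w}_n}(t)=0\}}{n}\ge\frac{\theta_2-\theta_1}{2\pi};$$ as a consequence, $$\liminf_{n\to\infty}\frac{\#\{t\in\mathcal{A}_R : \Delta_{\widehat{w}_n}(t)=0\}}{n}\ge\frac23.$$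
   Context: $\mathrm{Br}_3 = \langle \sigma_1, \sigma_2 \mid \sigma_1\sigma_2\sigma_1 = \sigma_2\sigma_1\sigma_2\rangle$ is the 3-strand braid group, and $\widehat{w}$ is the oriented link in $S^3$ that is the braid closure of $w$. The reduced Burau representation $B_t : \mathrm{Br}_3 \to \mathrm{GL}_2(\mathbb{Z}[t^{\pm1}])$ is given by $B_t(\sigma_1) = \begin{pmatrix} -t & 1\\ 0 & 1\end{pmatrix}$, $B_t(\sigma_2) = \begin{pmatrix} 1 & 0 \\ t & -t\end{pmatrix}$. The Alexander polynomial of $\widehat{w}$ is $\Delta_{\widehat{w}}(t) = \det(B_t(w)-I)/(t^2+t+1)\in\mathbb{Z}[t^{\pm1}]$, well defined up to units $\pm t^k$. The arcs are $\mathcal{A}_L = \{e^{i\theta} : |\theta-\pi|<\pi/3\}$, with closure $\overline{\mathcal{A}_L}$, and $\mathcal{A}_R=\{e^{i\theta} : |\theta|<2\pi/3\}$. $S^1$ is the unit circle in $\mathbb{C}$. *)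

(* Defs.v *)
From HB Require Import structures.
From mathcomp Require Import all_boot all_order all_algebra.
From mathcomp Require Import finmap ring.
From mathcomp Require Import generic_quotient fraction complex.
From mathcomp Require Import all_classical all_reals all_analysis.

Set Implicit Arguments.
Unset Strict Implicit.
Unset Printing Implicit Defensive.

Import Order.TTheory GRing.Theory Num.Theory.
Import numFieldNormedType.Exports.

Local Open Scope classical_set_scope.
Local Open Scope ring_scope.

Local Notation "x %:F" := (@FracField.tofrac _ x).

Definition is_laurent : {pred {fraction {poly int}}} :=
  fun f => `[< exists k (p : {poly int}), f * ('X^k)%:F = p%:F >].

Lemma is_laurent_subring : subring_closed is_laurent.
Proof.
split.
- by apply/asboolP; exists 0%N, 1; rewrite expr0 mulr1.
- move=> x y /asboolP[k [p xp]] /asboolP[l [q yq]]; apply/asboolP.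
  exists (k + l)%N, (p * 'X^l - q * 'X^k).
  rewrite exprD tofracM mulrBl mulrA xp tofracB !tofracM; congr (_ - _).
  by rewrite mulrCA yq mulrC.
- move=> x y /asboolP[k [p xp]] /asboolP[l [q yq]]; apply/asboolP.
  by exists (k + l)%N, (p * q); rewrite exprD !tofracM mulrACA xp yq.
Qed.

HB.instance Definition _ :=
  GRing.isSubringClosed.Build _ is_laurent is_laurent_subring.

Record laurent := Laurent {
  laurent_val :> {fraction {poly int}};
  laurentP : laurent_val \in is_laurent }.

HB.instance Definition _ := [isSub for laurent_val].
HB.instance Definition _ := [Choice of laurent by <:].
HB.instance Definition _ := [SubChoice_isSubComNzRing of laurent by <:].

Definition laurent_unit : {pred laurent} :=
  fun f => (val f != 0) && ((val f)^-1 \in is_laurent).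

Definition laurent_inv (f : laurent) : laurent := insubd f (val f)^-1.

Lemma laurent_mulVx : {in laurent_unit, left_inverse 1 laurent_inv *%R}.
Proof.
move=> f /andP[f0 fV]; apply: val_inj.
have -> : val (laurent_inv f * f) = val (laurent_inv f) * val f by [].
by rewrite (insubdK f fV) mulVf.
Qed.

Lemma laurent_unitPl (f g : laurent) : g * f = 1 -> laurent_unit f.
Proof.
move=> /(congr1 val) gf; have {gf} gf1 : val g * val f = 1 by [].
have f0 : val f != 0.
  by apply/eqP => f0; move: gf1; rewrite f0 mulr0 => /eqP; rewrite eq_sym oner_eq0.
rewrite /laurent_unit f0 /=.
suff -> : (val f)^-1 = val g by exact: valP.
by apply: (mulIf f0); rewrite mulVf ?gf1.
Qed.

Lemma laurent_invr_out : {in [predC laurent_unit], laurent_inv =1 id}.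
Proof.
move=> f nu; rewrite /laurent_inv.
have {nu} /orP[/eqP f0|fV] : (val f == 0) || ((val f)^-1 \notin is_laurent).
- by move: nu; rewrite inE /= unfold_in /laurent_unit negb_and negbK.
- by rewrite f0 invr0 -f0 /insubd valK.
- by rewrite /insubd insubN.
Qed.

HB.instance Definition _ := GRing.ComNzRing_hasMulInverse.Build laurent
  laurent_mulVx laurent_unitPl laurent_invr_out.

Lemma is_laurentX : 'X%:F \in is_laurent.
Proof. by apply/asboolP; exists 0%N, 'X; rewrite expr0 mulr1. Qed.

Definition tvar : laurent := Laurent is_laurentX.

Lemma is_laurentXV : ('X%:F)^-1 \in is_laurent.
Proof.
by apply/asboolP; exists 1%N, 1; rewrite expr1 mulVf // tofrac_eq0 polyX_eq0.
Qed.

Lemma tvar_unit : tvar \is a GRing.unit.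
Proof.
by apply/andP; split; rewrite ?is_laurentXV //= tofrac_eq0 polyX_eq0.
Qed.

Section Zeros.
Variable R : realType.

Lemma laurent_numP (f : laurent) :
  exists p : {poly int}, exists k, val f * ('X^k)%:F = p%:F.
Proof. by have /asboolP[k [p fp]] := valP f; exists p, k. Qed.

Definition laurent_num (f : laurent) : {poly int} := projT1 (cid (laurent_numP f)).

(* Meaningful for z != 0, where it does not depend on the numerator chosen
   (lemma [multE]); by the convention of [mup], it is 0 when f = 0. *)
Definition mult (z : R[i]) (f : laurent) : nat :=
  mup z (map_poly intr (laurent_num f)).

Lemma multE (z : R[i]) (f : laurent) (p : {poly int}) (k : nat) :
  z != 0 -> val f * ('X^k)%:F = p%:F -> mult z f = mup z (map_poly intr p).
Proof.
move=> z0 fp; rewrite /mult /laurent_num; case: cid => q [l fq] /=.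
have nr m : ~~ root ('X^m : {poly R[i]}) z by rewrite rootE hornerXn expf_neq0.
have /eqP : (q * 'X^k)%:F = (p * 'X^l)%:F by rewrite !tofracM -fp -fq mulrAC.
rewrite tofrac_eq => /eqP /(congr1 (map_poly (intr : int -> R[i]))).
rewrite !rmorphM /= !map_polyXn => e.
by rewrite -(mupMl _ (nr k)) e mupMl.
Qed.

(* Number of zeros in S, with multiplicity: the support of [mult ^~ f] on S is
   finite for f != 0 and 0 \notin S.  For f = 0 the value is 0, the convention
   under which a lower bound on it is the strongest. *)
Definition nzeros (S : set R[i]) (f : laurent) : nat :=
  \sum_(z \in S) mult z f.

Definition expi (theta : R) : R[i] := Complex (cos theta) (sin theta).

Definition S1 : set R[i] := [set z | `|z| = 1].

Definition arcL : set R[i] :=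
  [set expi theta | theta in [set theta | `|theta - pi| < pi / 3]].

Definition arcR : set R[i] :=
  [set expi theta | theta in [set theta | `|theta| < 2 * pi / 3]].

(* [closure] is the topological one; [R[i]^o] carries the usual topology. *)
Definition closed_arcL : set R[i] := closure (arcL : set (R[i])^o).

End Zeros.

Arguments S1 R : clear implicits.
Arguments arcL R : clear implicits.
Arguments arcR R : clear implicits.
Arguments closed_arcL R : clear implicits.

(* A letter (b, e) stands for sigma_1 (b = false) or sigma_2 (b = true), and for
   the inverse of this generator if e = true. *)
Definition letter := (bool * bool)%type.
Definition letter_inv (a : letter) : letter := (a.1, ~~ a.2).
Definition word := seq letter.
Definition word_inv (u : word) : word := rev (map letter_inv u).

Inductive braid_eq : word -> word -> Prop :=
| braid_eq_refl u : braid_eq u u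
| braid_eq_sym u v : braid_eq u v -> braid_eq v u
| braid_eq_trans u v w : braid_eq u v -> braid_eq v w -> braid_eq u w
| braid_eq_cat u u' v v' :
    braid_eq u u' -> braid_eq v v' -> braid_eq (u ++ v) (u' ++ v')
| braid_eq_cancel a : braid_eq [:: a; letter_inv a] [::]
| braid_eq_braid :
    braid_eq [:: (false, false); (true, false); (false, false)]
             [:: (true, false); (false, false); (true, false)].

Definition braid_eqb (u v : word) : bool := `[< braid_eq u v >].

Lemma braid_eqb_refl : reflexive braid_eqb.
Proof. by move=> u; apply/asboolP; exact: braid_eq_refl. Qed.

Lemma braid_eqb_sym : symmetric braid_eqb.
Proof. by move=> u v; apply/asboolP/asboolP => /braid_eq_sym. Qed.

Lemma braid_eqb_trans : transitive braid_eqb.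
Proof.
by move=> v u w /asboolP uv /asboolP vw; apply/asboolP; exact: braid_eq_trans vw.
Qed.

Definition braid_equiv := EquivRel braid_eqb
  braid_eqb_refl braid_eqb_sym braid_eqb_trans.

Local Open Scope quotient_scope.

Definition Br3 := {eq_quot braid_equiv}.
HB.instance Definition _ := Choice.on Br3.
HB.instance Definition _ := EqQuotient.on Br3.

Definition braid (u : word) : Br3 := \pi_Br3 u.

Lemma braidP (u v : word) : braid u = braid v <-> braid_eq u v.
Proof.
split => [/eqP|uv]; first by rewrite eqmodE => /asboolP.
by apply/eqP; rewrite eqmodE; apply/asboolP.
Qed.

Lemma braid_repr (x : Br3) : braid (repr x) = x.
Proof. exact: reprK. Qed.

Lemma repr_braid (u : word) : braid_eq (repr (braid u)) u.
Proof. by apply/braidP; rewrite braid_repr. Qed.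

Lemma letter_invK : involutive letter_inv.
Proof. by case=> b e; rewrite /letter_inv /= negbK. Qed.

Lemma word_invK : involutive word_inv.
Proof.
by move=> u; rewrite /word_inv map_rev revK mapK //; exact: letter_invK.
Qed.

Lemma word_inv_cat u v : word_inv (u ++ v) = word_inv v ++ word_inv u.
Proof. by rewrite /word_inv map_cat rev_cat. Qed.

Lemma braid_eq_mulV u : braid_eq (u ++ word_inv u) [::].
Proof.
elim: u => [|a u IHu]; first exact: braid_eq_refl.
rewrite -cat1s word_inv_cat catA -(catA [:: a]).
apply: (braid_eq_trans (v := [:: a] ++ word_inv [:: a])).
  apply: braid_eq_cat (braid_eq_refl _).
  by rewrite -[X in braid_eq _ X]cats0; apply: braid_eq_cat => //; apply: braid_eq_refl.
exact: braid_eq_cancel.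
Qed.

Lemma braid_eq_inv u v : braid_eq u v -> braid_eq (word_inv u) (word_inv v).
Proof.
move=> uv; apply: (braid_eq_trans (v := word_inv u ++ (v ++ word_inv v))).
  rewrite -[X in braid_eq X _]cats0; apply: braid_eq_cat (braid_eq_refl _) _.
  exact/braid_eq_sym/braid_eq_mulV.
rewrite catA -[X in braid_eq _ X]cat0s; apply: braid_eq_cat (braid_eq_refl _).
apply: (braid_eq_trans (v := word_inv u ++ u)).
  by apply: braid_eq_cat (braid_eq_refl _) (braid_eq_sym uv).
by rewrite -{2}[u]word_invK; exact: braid_eq_mulV.
Qed.

Definition Br3_one : Br3 := braid [::].
Definition Br3_mul (x y : Br3) : Br3 := braid (repr x ++ repr y).
Definition Br3_inv (x : Br3) : Br3 := braid (word_inv (repr x)).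

Lemma Br3_mulE u v : Br3_mul (braid u) (braid v) = braid (u ++ v).
Proof. by apply/braidP; apply: braid_eq_cat; exact: repr_braid. Qed.

Lemma Br3_invE u : Br3_inv (braid u) = braid (word_inv u).
Proof. by apply/braidP/braid_eq_inv/repr_braid. Qed.

Lemma Br3_mulA : associative Br3_mul.
Proof.
move=> x y z; rewrite -(braid_repr x) -(braid_repr y) -(braid_repr z).
by rewrite !Br3_mulE catA.
Qed.

Lemma Br3_mul1 : left_id Br3_one Br3_mul.
Proof. by move=> x; rewrite -(braid_repr x) Br3_mulE. Qed.

Lemma Br3_mulr1 : right_id Br3_one Br3_mul.
Proof. by move=> x; rewrite -(braid_repr x) Br3_mulE cats0. Qed.

Lemma Br3_mulV : right_inverse Br3_one Br3_inv Br3_mul.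
Proof.
move=> x; rewrite -(braid_repr x) Br3_invE Br3_mulE.
exact/braidP/braid_eq_mulV.
Qed.

Lemma Br3_mulVl : left_inverse Br3_one Br3_inv Br3_mul.
Proof.
move=> x; rewrite -(braid_repr x) Br3_invE Br3_mulE.
by apply/braidP; rewrite -{2}[repr x]word_invK; exact: braid_eq_mulV.
Qed.

HB.instance Definition _ := isGroup.Build Br3
  Br3_mulA Br3_mul1 Br3_mulr1 Br3_mulVl Br3_mulV.

Lemma braidM u v : (braid u * braid v)%g = braid (u ++ v).
Proof. exact: Br3_mulE. Qed.

HB.instance Definition _ := isPointed.Build Br3 Br3_one.

HB.instance Definition _ := @isMeasurable.Build default_measure_display
  Br3 discrete_measurable discrete_measurable0
  discrete_measurableC discrete_measurableU.

Definition sigma1 : Br3 := braid [:: (false, false)].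
Definition sigma2 : Br3 := braid [:: (true, false)].

Lemma braid_relation :
  (sigma1 * sigma2 * sigma1 = sigma2 * sigma1 * sigma2)%g.
Proof.
rewrite (braidM [:: (false, false)] [:: (true, false)]).
rewrite (braidM [:: (true, false)] [:: (false, false)]) !braidM.
by apply/braidP; exact: braid_eq_braid.
Qed.

Record GL2 := MkGL2 {
  GL2_val :> 'M[laurent]_2;
  GL2_unitP : GL2_val \in unitmx }.

HB.instance Definition _ := [isSub for GL2_val].
HB.instance Definition _ := [Choice of GL2 by <:].

Lemma GL2_one_subproof : 1%:M \in @unitmx laurent 2.
Proof. exact: unitmx1. Qed.
Lemma GL2_mul_subproof (A B : GL2) : GL2_val A *m B \in unitmx.
Proof. by rewrite unitmx_mul !GL2_unitP. Qed.
Lemma GL2_inv_subproof (A : GL2) : invmx (GL2_val A) \in unitmx.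
Proof. by rewrite unitmx_inv GL2_unitP. Qed.

Definition GL2_one : GL2 := MkGL2 GL2_one_subproof.
Definition GL2_mul (A B : GL2) : GL2 := MkGL2 (GL2_mul_subproof A B).
Definition GL2_inv (A : GL2) : GL2 := MkGL2 (GL2_inv_subproof A).

Lemma GL2_mulA : associative GL2_mul.
Proof. by move=> A B C; apply: val_inj; rewrite /= mulmxA. Qed.
Lemma GL2_mul1 : left_id GL2_one GL2_mul.
Proof. by move=> A; apply: val_inj; rewrite /= mul1mx. Qed.
Lemma GL2_mulr1 : right_id GL2_one GL2_mul.
Proof. by move=> A; apply: val_inj; rewrite /= mulmx1. Qed.
Lemma GL2_mulVl : left_inverse GL2_one GL2_inv GL2_mul.
Proof. by move=> A; apply: val_inj; rewrite /= mulVmx // GL2_unitP. Qed.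
Lemma GL2_mulV : right_inverse GL2_one GL2_inv GL2_mul.
Proof. by move=> A; apply: val_inj; rewrite /= mulmxV // GL2_unitP. Qed.

HB.instance Definition _ := isGroup.Build GL2
  GL2_mulA GL2_mul1 GL2_mulr1 GL2_mulVl GL2_mulV.

Definition mat2 (K : Type) (a b c d : K) : 'M[K]_2 :=
  \matrix_(i, j) if i == 0 then (if j == 0 then a else b)
                 else (if j == 0 then c else d).

Lemma det_mat2 (K : comNzRingType) (a b c d : K) :
  \det (mat2 a b c d) = a * d - b * c.
Proof.
rewrite (expand_det_row _ 0) !big_ord_recl big_ord0 addr0 /cofactor !det_mx11 !mxE /=.
by rewrite expr0 expr1 mul1r mulN1r mulrN.
Qed.

Lemma mul_mat2 (K : comNzRingType) (a b c d a' b' c' d' : K) :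
  mat2 a b c d *m mat2 a' b' c' d' =
  mat2 (a * a' + b * c') (a * b' + b * d') (c * a' + d * c') (c * b' + d * d').
Proof.
apply/matrixP => i j; rewrite !mxE !big_ord_recl big_ord0 addr0 !mxE /=.
by do 2!case: ifP.
Qed.

Definition burau_sigma1_mx : 'M[laurent]_2 := mat2 (- tvar) 1 0 1.
Definition burau_sigma2_mx : 'M[laurent]_2 := mat2 1 0 tvar (- tvar).

Lemma burau_sigma1_unit : burau_sigma1_mx \in unitmx.
Proof. by rewrite unitmxE det_mat2 mulr1 mulr0 subr0 unitrN tvar_unit. Qed.
Lemma burau_sigma2_unit : burau_sigma2_mx \in unitmx.
Proof. by rewrite unitmxE det_mat2 mul1r mul0r subr0 unitrN tvar_unit. Qed.

Definition burau_letter (a : letter) : GL2 :=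
  let B := if a.1 then MkGL2 burau_sigma2_unit else MkGL2 burau_sigma1_unit in
  if a.2 then (B^-1)%g else B.

Definition burau_word (u : word) : GL2 := (\prod_(a <- u) burau_letter a)%g.

Lemma burau_word_cat u v : burau_word (u ++ v) = (burau_word u * burau_word v)%g.
Proof. by rewrite /burau_word big_cat. Qed.

Lemma burau_word_eq u v : braid_eq u v -> burau_word u = burau_word v.
Proof.
elim=> //.
- by move=> {}u {}v w _ -> _ ->.
- by move=> ? ? ? ? _ IHu _ IHv; rewrite !burau_word_cat IHu IHv.
- move=> [b e]; rewrite /burau_word !big_cons !big_nil mulg1 /burau_letter /=.
  by case: e => /=; rewrite ?mulgV ?mulVg.
- rewrite /burau_word !big_cons !big_nil !mulg1 /burau_letter /=.
  apply: val_inj; rewrite /= /burau_sigma1_mx /burau_sigma2_mx !mul_mat2.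
  by congr mat2; rewrite ?(mulr0, mul0r, mulr1, mul1r, addr0, add0r, mulNr, mulrN,
    opprK, subrr, addNr).
Qed.

Definition burau (x : Br3) : GL2 := burau_word (repr x).

Lemma burau_braid u : burau (braid u) = burau_word u.
Proof. exact/burau_word_eq/repr_braid. Qed.

Lemma burauM (x y : Br3) : burau (x * y)%g = (burau x * burau y)%g.
Proof.
by rewrite -(braid_repr x) -(braid_repr y) braidM !burau_braid burau_word_cat.
Qed.

Lemma burau1 : burau 1%g = 1%g.
Proof. by rewrite [LHS]burau_braid /burau_word big_nil. Qed.

HB.instance Definition _ :=
  isUMagmaMorphism.Build Br3 GL2 burau (burau1, burauM).

Lemma burau_sigma1 : burau sigma1 = mat2 (- tvar) 1 0 1 :> 'M[laurent]_2.
Proof. by rewrite burau_braid /burau_word big_seq1. Qed.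

Lemma burau_sigma2 : burau sigma2 = mat2 1 0 tvar (- tvar) :> 'M[laurent]_2.
Proof. by rewrite burau_braid /burau_word big_seq1. Qed.

Lemma sigma1_neq_sigma2 : sigma1 <> sigma2.
Proof.
move=> /(congr1 (fun x => (burau x : 'M[laurent]_2) 0 1)).
by rewrite burau_sigma1 burau_sigma2 !mxE /= => /eqP; rewrite oner_eq0.
Qed.

Definition burau_vec : 'cV[laurent]_2 := \col_i (if i == 0 then 1 else 1 + tvar).

Lemma burau_fix (x : Br3) : exists c : 'cV[laurent]_2,
  (burau x : 'M[laurent]_2) *m burau_vec = burau_vec + (tvar ^+ 2 + tvar + 1) *: c.
Proof.
rewrite -(braid_repr x) burau_braid; elim: (repr x) => [|a u [c IHc]].
  by exists 0; rewrite /burau_word big_nil [LHS]mul1mx scaler0 addr0.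
have gen (B := if a.1 then MkGL2 burau_sigma2_unit else MkGL2 burau_sigma1_unit) :
    exists c : 'cV[laurent]_2,
    (B : 'M[laurent]_2) *m burau_vec = burau_vec + (tvar ^+ 2 + tvar + 1) *: c.
  rewrite {}/B; case: a.1 => /=; last first.
    exists 0; apply/colP => i.
    rewrite !mxE !big_ord_recl big_ord0 !mxE /=.
    by case: ifP => _; ring.
  exists (\col_i (if i == 0 then 0 else -1)); apply/colP => i.
  rewrite !mxE !big_ord_recl big_ord0 !mxE /=.
  by case: ifP => _; ring.
have [c' Hc'] : exists c : 'cV[laurent]_2,
    (burau_letter a : 'M[laurent]_2) *m burau_vec = burau_vec + (tvar ^+ 2 + tvar + 1) *: c.
  rewrite /burau_letter; case: a.2 => //; move: gen; cbv zeta.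
  move: (if a.1 then _ else _) => B [c1 Hc1].
  exists (- (invmx (B : 'M[laurent]_2) *m c1)) => /=.
  have := congr1 (mulmx (invmx (B : 'M[laurent]_2))) Hc1.
  rewrite mulmxA mulVmx ?GL2_unitP // mul1mx mulmxDr -scalemxAr scalerN => e.
  by rewrite [in RHS]e addrK.
exists (c' + (burau_letter a : 'M[laurent]_2) *m c).
rewrite /burau_word big_cons /= -mulmxA IHc mulmxDr Hc' -scalemxAr -addrA.
by rewrite scalerDr.
Qed.

Lemma alexander_subproof (x : Br3) :
  exists D : laurent, D * (tvar ^+ 2 + tvar + 1) = \det ((burau x : 'M[laurent]_2) - 1%:M).
Proof.
have [c Hc] := burau_fix x; set M := _ - _.
exists ((\adj M *m c) 0 0).
have Mv : M *m burau_vec = (tvar ^+ 2 + tvar + 1) *: c.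
  by rewrite mulmxBl Hc mul1mx addrC addKr.
have := congr1 (fun A => (\adj M *m A) 0 0) Mv.
rewrite mulmxA mul_adj_mx mul_scalar_mx -scalemxAr [LHS]mxE [RHS]mxE.
by rewrite [burau_vec _ _]mxE /= mulr1 => ->; rewrite mulrC.
Qed.

(* Representative of the Alexander polynomial (defined up to units of the form
   +/- t^k) of the closure of x: the exact quotient of det (B_t(x) - I) by
   t^2 + t + 1 in Z[t, t^-1]. *)
Definition alexander (x : Br3) : laurent := projT1 (cid (alexander_subproof x)).

Lemma alexanderP (x : Br3) :
  alexander x * (tvar ^+ 2 + tvar + 1) = \det ((burau x : 'M[laurent]_2) - 1%:M).
Proof. exact: projT2 (cid (alexander_subproof x)). Qed.

Section Random.
Context (d d' : measure_display) (Omega : measurableType d)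
  (T : measurableType d') (R : realType) (P : probability Omega R).

Definition mutually_independent (I : choiceType) (X : I -> {RV P >-> T}) : Prop :=
  forall (J : {fset I}) (A : I -> set T),
    (forall i, measurable (A i)) ->
    P (\bigcap_(i in [set` J]) (X i @^-1` A i)) =
    (\prod_(i <- J) P (X i @^-1` A i))%E.

(* Uniform distribution on {x, y}, for x <> y. *)
Definition uniform_pair (x y : T) (X : {RV P >-> T}) : Prop :=
  distribution P X [set x] = (2^-1)%:E /\ distribution P X [set y] = (2^-1)%:E.

End Random.

(* [g i] is the (i+1)-st step of the walk. *)
Definition braid_walk (Omega : Type) (g : nat -> Omega -> Br3) (n : nat)
  (omega : Omega) : Br3 := (\prod_(i < n) g i omega)%g.

Definition zero_density (R : realType) (S : set R[i]) (w : nat -> Br3) : \bar R :=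
  limn_einf (fun n => ((nzeros S (alexander (w n)))%:R / n%:R)%:E).

(* Main.v *)
Require Import Defs.
From HB Require Import structures.
From mathcomp Require Import all_boot all_order all_algebra.
From mathcomp Require Import finmap ring lra zify.
From mathcomp Require Import fraction complex.
From mathcomp Require Import all_classical all_reals all_analysis.

Set Implicit Arguments.
Unset Strict Implicit.
Unset Printing Implicit Defensive.

Import Order.TTheory GRing.Theory Num.Theory.
Import numFieldNormedType.Exports.

Local Open Scope classical_set_scope.
Local Open Scope ring_scope.

(** Write t = - v ^ 2 and y = v + 1 / v.  On the unit circle, t = e ^ (i theta)
    gives y = 2 sin (theta / 2), and ]-pi, pi[ is mapped bijectively onto
    ]-2, 2[.  For a positive word s of length n, the determinant of
    B_t(s) - 1 equals 1 - tr B_t(s) + (- t) ^ n, that is, v ^ n times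
    C_n(y) - v ^ (- n) tr B_t(s), with C_n(2 cos x) = 2 cos (n x)
    ([burau_det_closing]).  The matrices B_t(sigma_i) / v generate a
    quaternion algebra over the field of rational functions of y, so that this
    difference is a real polynomial in y, and its real roots in ]-2, 2[ are
    zeros of the Alexander polynomial on the unit circle, with at least the
    same multiplicities ([nzeros_root_list]).  Real roots are produced by one
    principle: a real polynomial with weakly alternating signs at m + 1 points
    has m roots between them ([alternating_roots]).

    On the right arc, y ^ 2 < 3, the algebra is definite: the normalized
    matrices are unitary and their traces lie in [-2, 2].  The polynomial thus
    alternates at the points where C_n is 2 or - 2, which are equidistributed in
    theta.  This gives the densities on the right arc, without any probability
    ([right_arc_roots]).

    On the left arc, y ^ 2 >= 3, the algebra splits and the normalized matrices
    are real.  The word turns the row vector (1, 0) by a total angle which is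
    continuous in y.  Where this angle is a multiple of pi the matrix is
    triangular, and the sign of the polynomial is opposite to that of the
    diagonal entry; hence every multiple of pi between the values of the angle
    at the two ends of the arc contributes a sign alternation
    ([left_arc_roots]).  At y = sqrt 3 both generators are the rotation by
    pi / 6, so the angle is n pi / 6.

    At the other end, t = - 1, the generators act on the plane as the elementary
    matrices of SL_2(Z), and the angle grows by quarter turns.  The direction of
    the vector is encoded by a stack of binary symbols (its continued fraction),
    so that the number J_n of quarter turns follows a random walk on stacks
    ([scaled_row2_walk], [angle2_walk]).  The sum of J_n and of a bounded
    potential on stacks, built from the golden ratio, is a martingale up to the
    exact drift (sqrt 5 - 1) / 4 per step ([level_walk_step]).  An exponential
    moment estimate and the Borel-Cantelli lemma then bound limsup J_n / n by
    this number, almost surely.  The two halves of the left arc carry together at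
    least 2 (n / 6 - J_n / 2) - O(1) zeros, of density
    (7 - 3 sqrt 5) / 12; the zeros of the right arc add 2 / 3 to this,
    which makes (5 - sqrt 5) / 4. *)

(** * Roots of real polynomials with weakly alternating signs *)

(** Multiplicities are carried by lists: a repeated entry stands for a multiple
    root.  Compared with divisibility by the product of the linear factors, this
    form is immediately stable under concatenation of disjoint lists. *)
Definition root_list (F : fieldType) (p : {poly F}) (rs : seq F) : Prop :=
  forall r, (count_mem r rs <= mup r p)%N.

Lemma root_list_dvdp (F : fieldType) (p : {poly F}) rs :
  p != 0 -> \prod_(r <- rs) ('X - r%:P) %| p -> root_list p rs.
Proof.
move=> p0 /dvdpP[q pE] r.
have [q0 r0] : q != 0 /\ \prod_(r <- rs) ('X - r%:P) != 0.
  by apply/andP; rewrite -negb_or -mulf_eq0 -pE.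
by rewrite pE mupM // mu_prod_XsubC leq_addl.
Qed.

Lemma root_list_cat (F : fieldType) (p : {poly F}) rs1 rs2 :
  (forall r, r \in rs1 -> r \in rs2 -> False) ->
  root_list p rs1 -> root_list p rs2 -> root_list p (rs1 ++ rs2).
Proof.
move=> dis H1 H2 r; rewrite count_cat.
have [r1|/count_memPn->] := boolP (r \in rs1); last exact: H2.
suff /count_memPn-> : r \notin rs2 by rewrite addn0.
by apply/negP => /(dis _ r1).
Qed.

(** Weak inequalities suffice because roots are counted with multiplicity.  By
    induction on [m]: a root [r] between the first two points is divided out,
    which changes the sign of the values to the left of [r] only.  The quotient
    alternates at the points after [r]; if [r] is the second point, where the
    quotient has no known sign, the first point replaces it, since its sign has
    been reversed. *)
Lemma alternating_roots (R : rcfType) (m : nat) : forall (p : {poly R}) (a : nat -> R),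
  (forall k, (k < m)%N -> a k < a k.+1) ->
  (forall k, (k <= m)%N -> 0 <= (-1) ^+ k * p.[a k]) ->
  exists rs : seq R, [/\ size rs = m, all (fun r => a 0%N <= r <= a m) rs &
    \prod_(r <- rs) ('X - r%:P) %| p].
Proof.
elim: m => [|m IH] p a alt sgn.
  by exists [::]; split=> //; rewrite big_nil dvd1p.
have a01 : a 0%N <= a 1%N by exact/ltW/alt.
have [r /andP[r0 r1] pr0] : exists2 r, a 0%N <= r <= a 1%N & root p r.
  have s0 := sgn 0%N isT; have s1 := sgn 1%N isT.
  have [r rI pr] : exists2 r, a 0%N <= r <= a 1%N & root (- p) r.
    apply: poly_ivt => //; rewrite !hornerN oppr_le0 oppr_ge0.
    by move: s0 s1; rewrite expr0 mul1r expr1 mulN1r oppr_ge0 => -> ->.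
  by exists r => //; rewrite -rootN.
have /factor_theorem[q pq] := pr0.
pose a' k := if k == 0%N then (if r < a 1%N then a 1%N else a 0%N) else a k.+1.
have am k : (k <= m.+1)%N -> forall l, (l <= k)%N -> a l <= a k.
  elim: k => [|k IHk] km l; first by rewrite leqn0 => /eqP->.
  rewrite leq_eqVlt => /orP[/eqP->//|]; rewrite ltnS => lk.
  by apply: le_trans (IHk (ltnW km) _ lk) (ltW (alt _ _)).
have sgn' k : (k <= m.+1)%N -> r < a k -> 0 <= (-1) ^+ k * q.[a k].
  move=> km rk; have := sgn k km; rewrite pq hornerM hornerXsubC mulrA.
  by rewrite pmulr_lge0 // subr_gt0.
case: (IH (- q) a').
- move=> k km; have m0 : (0 < m)%N := leq_ltn_trans (leq0n k) km.
  rewrite /a' /=; case: eqP => [->|_]; last exact: alt.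
  have a12 : a 1%N < a 2%N by exact: alt.
  by case: ifP => // _; apply: lt_trans a12; apply: alt.
- move=> k km; rewrite /a' hornerN mulrN -mulNr -[- _]mulN1r -exprS.
  case: eqP => [->|/eqP k0].
    case: ifP => r1'; first exact: sgn'.
    have {r1'} ra1 : r = a 1%N by apply/eqP; rewrite eq_le r1 leNgt r1'.
    have := sgn 0%N isT; rewrite pq hornerM hornerXsubC expr1 expr0 mul1r mulN1r.
    by rewrite nmulr_lge0 ?oppr_ge0 // subr_lt0 ra1; apply: alt.
  apply: sgn' => //; apply: le_lt_trans r1 _.
  apply: lt_le_trans (alt 1%N _) _; first by rewrite ltnS (leq_trans _ km) // lt0n.
  by apply: am; rewrite ltnS // lt0n.
move=> rs [srs rsI rsd]; exists (r :: rs); split => /=.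
- by rewrite srs.
- rewrite r0 (le_trans r1 (am _ _ _ _)) //=.
  apply/allP => z /(allP rsI) /andP[z0 z1]; apply/andP; split.
    apply: le_trans z0; rewrite /a' /=; case: ifP => //.
  apply: le_trans z1 _; rewrite /a'; case: eqP => // m0.
  by case: ifP => _; rewrite m0 //.
- by rewrite big_cons mulrC pq dvdp_mul2r ?polyXsubC_eq0 // -dvdpNr.
Qed.

(** * Positive words in a quaternion algebra *)

(** Coordinates on the basis 1, j, - k, k j of a quaternion algebra with
    j ^ 2 = - 1, k ^ 2 = y ^ 2 - 3 and k j = - j k.  When x ^ 2 = y ^ 2 - 3 this
    element is the matrix with rows (qa - x qd, qb + x qe) and
    (- qb + x qe, qa + x qd). *)
Record quat (K : Type) := Quat { qa : K; qb : K; qd : K; qe : K }.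

Section QuaternionWords.
Variable K : comNzRingType.
Implicit Types (y t : K) (s : seq bool).

(** Right multiplication by y + j - k (for sigma_1) or y + j + k (for sigma_2),
    which are twice the images of the generators; the factor 2 keeps the
    coordinates in Z[y]. *)
Definition qstep y (q : quat K) (b : bool) : quat K :=
  let k := y ^+ 2 - 3 in let e := (-1) ^+ b in
  Quat (y * qa q + e * k * qd q - qb q) (qa q + y * qb q + e * k * qe q)
       (e * qa q + y * qd q + qe q) (- qd q + y * qe q + e * qb q).

Definition qword y s : quat K := foldl (qstep y) (Quat 1 0 0 0) s.

Lemma qword_rcons y s b : qword y (rcons s b) = qstep y (qword y s) b.
Proof. by rewrite /qword -cats1 foldl_cat. Qed.

(** The reduced norm is multiplicative, and y + j - k and y + j + k have
    norm 4. *)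
Lemma qnorm y s : let q := qword y s in
  qa q ^+ 2 + qb q ^+ 2 - (y ^+ 2 - 3) * (qd q ^+ 2 + qe q ^+ 2) = 4 ^+ size s.
Proof.
elim/last_ind: s => [|s b IH] /=; first by rewrite /= expr0; ring.
rewrite qword_rcons size_rcons [in RHS]exprS -IH /qstep /=.
by case: b; rewrite ?expr1 ?expr0; ring.
Qed.

(** The polynomials 2 T_n(y / 2), with T_n the Chebyshev polynomials of the first
    kind. *)
Fixpoint cheb y n : K :=
  match n with
  | 0 => 2
  | 1 => y
  | (m.+1 as p).+1 => y * cheb y p - cheb y m
  end.

Lemma chebSS y n : cheb y n.+2 = y * cheb y n.+1 - cheb y n.
Proof. by []. Qed.

(** The determinant of B_t(s) - 1, up to a unit, in the variable y.  It is
    computed in an arbitrary ring, so that the same expression is a polynomial,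
    its values at real numbers and its values at complex numbers. *)
Definition closing y s : K :=
  2 ^+ size s * cheb y (size s) - 2 * qa (qword y s).

Lemma chebN y n : cheb (- y) n = (-1) ^+ n * cheb y n.
Proof.
suff [] : cheb (- y) n = (-1) ^+ n * cheb y n /\
  cheb (- y) n.+1 = (-1) ^+ n.+1 * cheb y n.+1 by [].
elim: n => [|n [IH1 IH2]]; first by rewrite /= expr0 expr1; split; ring.
by split=> //; rewrite !chebSS IH1 IH2 !exprS; ring.
Qed.

Lemma qwordN y s : qword (- y) s =
  let q := qword y s in let e := (-1) ^+ size s in
  Quat (e * qa q) (- e * qb q) (- e * qd q) (e * qe q).
Proof.
elim/last_ind: s => [|s b IH] /=; first by congr Quat; rewrite /= ?expr0; ring.
rewrite !qword_rcons IH size_rcons exprS /qstep /=.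
by congr Quat; ring.
Qed.

Lemma closingN y s : closing (- y) s = (-1) ^+ size s * closing y s.
Proof. by rewrite /closing chebN qwordN /=; ring. Qed.

Definition burau_mx t s : 'M[K]_2 :=
  foldl (fun M (b : bool) => M *m (if b then mat2 1 0 t (- t) else mat2 (- t) 1 0 1))
    1%:M s.

Lemma burau_mx_rcons t s b : burau_mx t (rcons s b) =
  burau_mx t s *m (if b then mat2 1 0 t (- t) else mat2 (- t) 1 0 1).
Proof. by rewrite /burau_mx -cats1 foldl_cat. Qed.

Definition burau_det t s : K := \det (burau_mx t s - 1%:M).

Lemma mat2_1 : 1%:M = mat2 1 0 0 1 :> 'M[K]_2.
Proof.
apply/matrixP => i j; rewrite !mxE.
by case: i j => [[|[|//]] ?] [[|[|//]] ?].
Qed.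

End QuaternionWords.

Section Morphism.
Variables (K L : comNzRingType) (f : {rmorphism K -> L}).

Lemma rmorph_cheb y n : f (cheb y n) = cheb (f y) n.
Proof.
suff [] : f (cheb y n) = cheb (f y) n /\ f (cheb y n.+1) = cheb (f y) n.+1 by [].
elim: n => [|n [IH1 IH2]]; first by rewrite /= rmorph_nat.
by split=> //; rewrite !chebSS rmorphB rmorphM /= IH1 IH2.
Qed.

Lemma rmorph_qword y s : let q := qword y s in
  qword (f y) s = Quat (f (qa q)) (f (qb q)) (f (qd q)) (f (qe q)).
Proof.
elim/last_ind: s => [|s b IH] /=; first by rewrite /= rmorph1 rmorph0.
rewrite !qword_rcons IH /qstep /=.
by congr Quat;
  rewrite !(rmorph_nat, rmorph_sign, rmorphD, rmorphB, rmorphM, rmorphN, rmorphXn).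
Qed.

Lemma rmorph_closing y s : f (closing y s) = closing (f y) s.
Proof.
by rewrite /closing rmorphB !rmorphM rmorphXn rmorph_nat rmorph_cheb rmorph_qword.
Qed.

Lemma map_mat2 (a b c d : K) :
  map_mx f (mat2 a b c d) = mat2 (f a) (f b) (f c) (f d).
Proof. by apply/matrixP => i j; rewrite !mxE; do 2 case: ifP => _. Qed.

Lemma map_burau_mx t s : map_mx f (burau_mx t s) = burau_mx (f t) s.
Proof.
elim/last_ind: s => [|s b IH]; first by rewrite /burau_mx /= map_mx1.
rewrite !burau_mx_rcons map_mxM IH; congr (_ *m _).
by case: b; rewrite map_mat2 rmorphN rmorph0 rmorph1.
Qed.

Lemma rmorph_burau_det t s : f (burau_det t s) = burau_det (f t) s.
Proof.
by rewrite /burau_det -det_map_mx map_mxB map_burau_mx map_mx1.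
Qed.

End Morphism.

Section Field.
Variable (F : fieldType).
Implicit Types (v : F) (s : seq bool).

Lemma cheb_inv v n : v != 0 -> cheb (v + v^-1) n = v ^+ n + v ^- n.
Proof.
move=> v0; suff [] : cheb (v + v^-1) n = v ^+ n + v ^- n /\
  cheb (v + v^-1) n.+1 = v ^+ n.+1 + v ^- n.+1 by [].
elim: n => [|n [IH1 IH2]]; first by rewrite /= expr0 expr1 invr1.
split=> //; rewrite chebSS IH1 IH2.
by rewrite -!exprVn !exprS; move: (v ^+ n) (v^-1 ^+ n) => p q; field.
Qed.

(** The matrices j = (0, 1 / v; - v, 0) and
    k = (1 / v - v, - 1 / v; - v, v - 1 / v) satisfy the relations of the
    quaternion algebra, and 2 B_t(sigma_i) / v is y + j - k or y + j + k. *)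
Lemma burau_quat v s : v != 0 -> let q := qword (v + v^-1) s in
  2 ^+ size s *: burau_mx (- v ^+ 2) s = v ^+ size s *:
   mat2 (qa q - qd q * (v^-1 - v) + qe q)
        ((qb q + qd q) / v + qe q * (v ^- 2 - 1))
        ((qd q - qb q) * v + qe q * (1 - v ^+ 2))
        (qa q + qd q * (v^-1 - v) - qe q).
Proof.
move=> v0; elim/last_ind: s => [|s b IH] /=.
  rewrite !expr0 !scale1r /burau_mx /= mat2_1; congr mat2; ring.
rewrite qword_rcons size_rcons burau_mx_rcons [2 ^+ _]exprS [v ^+ (size s).+1]exprSr.
rewrite -[RHS]scalerA -[LHS]scalerA scalemxAl IH -scalemxAl [LHS]scalerA mulrC.
rewrite -[LHS]scalerA.
congr (_ *: _); move: (qword _ _) => [A B D E] /=.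
by case: b; rewrite mul_mat2; apply/matrixP => i j; rewrite !mxE;
  do 2 case: ifP => _; rewrite ?expr0 ?expr1; field.
Qed.

Lemma det_burau_mx (t : F) s : \det (burau_mx t s) = (- t) ^+ size s.
Proof.
elim/last_ind: s => [|s b IH]; first by rewrite /burau_mx /= det1.
rewrite burau_mx_rcons det_mulmx IH size_rcons exprSr; congr (_ * _).
by case: b; rewrite det_mat2; ring.
Qed.

Lemma mat2E (M : 'M[F]_2) : M = mat2 (M 0 0) (M 0 1) (M 1 0) (M 1 1).
Proof.
apply/matrixP => i j; rewrite !mxE.
by case: i j => [[|[|//]] ?] [[|[|//]] ?] /=; congr (M _ _); apply: val_inj.
Qed.

Lemma det_subr1 (M : 'M[F]_2) : \det (M - 1%:M) = 1 - (M 0 0 + M 1 1) + \det M.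
Proof.
have -> : M - 1%:M = mat2 (M 0 0 - 1) (M 0 1) (M 1 0) (M 1 1 - 1).
  by rewrite [LHS]mat2E; congr mat2; rewrite !mxE /= ?subr0.
by rewrite [X in _ + \det X]mat2E !det_mat2; ring.
Qed.

Lemma burau_det_closing v s : v != 0 ->
  2 ^+ size s * burau_det (- v ^+ 2) s = v ^+ size s * closing (v + v^-1) s.
Proof.
move=> v0; rewrite /burau_det det_subr1 det_burau_mx opprK /closing cheb_inv //.
have /matrixP H := burau_quat s v0.
have := H 0 0; have := H 1 1; rewrite !mxE /= => H1 H0.
rewrite mulrDr mulrBr mulrDr H0 H1 -exprM mulnC exprM.
have w0 : v ^+ size s != 0 by rewrite expf_neq0.
move: (v ^+ size s) (2 ^+ size s) (v^-1) w0 (qword _ _) => w c u w0 [A B D E] /=.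
by field.
Qed.

End Field.

(** * Multiplicities under the substitution y = v + 1/v, t = - v^2 *)

(** In characteristic 0 there are infinitely many nonzero points. *)
Lemma poly_eq_off0 (F : fieldType) (p q : {poly F}) : [pchar F] =i pred0 ->
  (forall v, v != 0 -> p.[v] = q.[v]) -> p = q.
Proof.
move=> /pcharf0P ch0 pq; apply/eqP; rewrite -subr_eq0; apply: contraT => d0.
have := max_poly_roots (rs := [seq n.+1%:R | n <- iota 0 (size (p - q))]) d0.
rewrite size_map size_iota ltnn => -> //.
  apply/allP => _ /mapP[n _ ->]; rewrite rootE hornerD hornerN subr_eq0.
  by rewrite pq // ch0.
rewrite map_inj_uniq ?iota_uniq //.
suff inj i j : (i <= j)%N -> i.+1%:R = j.+1%:R :> F -> i = j.
  by move=> i j; have [ij /(inj _ _ ij)|/ltnW ji /esym/(inj _ _ ji)] := leqP i j.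
move=> ij /eqP; rewrite eq_sym -subr_eq0 -natrB // subSS ch0 subn_eq0 => ji.
by apply/eqP; rewrite eqn_leq ij.
Qed.

Lemma homogenization (F : fieldType) (p : {poly F}) :
  exists N (T : {poly F}), forall v : F, v != 0 -> T.[v] = v ^+ N * p.[v + v^-1].
Proof.
elim/poly_ind: p => [|p c [N [T TE]]].
  by exists 0%N, 0 => v _; rewrite !horner0 mulr0.
exists N.+1, (T * ('X^2 + 1) + c%:P * 'X^(N.+1)) => v v0.
by rewrite !hornerE TE // [v ^+ N.+1]exprS; field.
Qed.

(** Near v0 the map v -> - v ^ 2 is a local coordinate, so the multiplicity of
    [p] at - v0 ^ 2 is that of the common value of both sides at v0, where the
    factor v + 1 / v - y0 vanishes at least once. *)
Lemma mup_pullback (F : fieldType) (p q : {poly F}) (c : F) n (v0 : F) :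
  [pchar F] =i pred0 ->
  p != 0 -> q != 0 -> c != 0 -> v0 != 0 ->
  (forall v, v != 0 -> c * p.[- v ^+ 2] = v ^+ n * q.[v + v^-1]) ->
  (mup (v0 + v0^-1) q <= mup (- v0 ^+ 2) p)%N.
Proof.
move=> ch0 p0 q0 c0 v00 pq; rewrite leqNgt; apply/negP.
set k := mup _ q; set m := mup _ p => mk.
have /dvdpP[S SE] : ('X - (v0 + v0^-1)%:P) ^+ k %| q by rewrite -mup_geq.
have /dvdpP[P1 PE] : ('X - (- v0 ^+ 2)%:P) ^+ m %| p by rewrite -mup_geq.
have P1z : ~~ root P1 (- v0 ^+ 2).
  apply/negP => /factor_theorem[P2 P2E].
  have : (m.+1 <= m)%N by rewrite {2}/m mup_geq // PE P2E -mulrA -exprS dvdp_mull.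
  by rewrite ltnn.
have [N [T TE]] := homogenization S.
pose L := c *: ('X^(N + k) * (-1) ^+ m * ('X + v0%:P) ^+ m * (P1 \Po (- 'X^2))).
pose M := 'X^n * ('X - v0%:P) ^+ (k - m) * ('X - v0^-1%:P) ^+ k * T.
(* At v0 the left side does not vanish, and the right side does. *)
suff : L = M.
  move=> /(congr1 (horner^~ v0)); rewrite /L /M !hornerE /= subrr.
  rewrite expr0n subn_eq0 leqNgt mk !(mulr0, mul0r) => /eqP.
  rewrite !mulf_eq0 (negbTE c0) !expf_eq0 (negbTE v00) !andbF oppr_eq0 oner_eq0 andbF /=.
  rewrite -mulr2n -mulr_natr mulf_eq0 (negbTE v00) ((pcharf0P F).1 ch0) andbF /=.
  by rewrite horner_comp !hornerE -rootE (negbTE P1z).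
suff : ('X - v0%:P) ^+ m * L = ('X - v0%:P) ^+ m * M.
  by apply: mulfI; rewrite expf_neq0 // polyXsubC_eq0.
apply: (poly_eq_off0 ch0) => v vn0; have := pq v vn0.
rewrite SE PE /L /M !hornerE !horner_comp !hornerE /= TE // => E.
have -> : (v - v0) ^+ m * v ^+ n * (v - v0) ^+ (k - m) * (v - v0^-1) ^+ k *
   (v ^+ N * S.[v + v^-1]) =
   v ^+ (N + k) * (v ^+ n * S.[v + v^-1] * (v + v^-1 - (v0 + v0^-1)) ^+ k).
  have -> : v + v^-1 - (v0 + v0^-1) = (v - v0) * (v - v0^-1) * v^-1 by field; rewrite vn0.
  rewrite !exprMn -(congr1 (GRing.exp (v - v0)) (subnKC (ltnW mk))) !exprD exprVn.
  have vk : v ^+ k != 0 by rewrite expf_neq0.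
  move: ((v - v0) ^+ m) ((v - v0) ^+ (k - m)) ((v - v0^-1) ^+ k) (v ^+ k) vk => x1 x2 x3 x4 vk.
  by field.
rewrite -E; have -> : - v ^+ 2 - - v0 ^+ 2 = -1 * (v - v0) * (v + v0) by ring.
rewrite !exprMn; move: (v ^+ _) ((v - v0) ^+ m) ((v + v0) ^+ m) ((-1) ^+ m) => x1 x2 x3 x4.
by ring.
Qed.

(** * Zeros of the Alexander polynomial on the unit circle *)

Definition sigma (b : bool) : Br3 := if b then sigma2 else sigma1.

Definition braid_of (s : seq bool) : Br3 := (\prod_(b <- s) sigma b)%g.

Lemma braid_of_rcons s b : braid_of (rcons s b) = (braid_of s * sigma b)%g.
Proof. by rewrite /braid_of -cats1 big_cat big_seq1. Qed.

Lemma burau_braid_of s :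
  (burau (braid_of s) : 'M[laurent]_2) = burau_mx tvar s.
Proof.
elim/last_ind: s => [|s b IH].
  by rewrite /braid_of big_nil burau1 /burau_mx /=.
rewrite braid_of_rcons burauM burau_mx_rcons /= IH; congr (_ *m _).
by case: b; rewrite /= (burau_sigma1, burau_sigma2).
Qed.

(** At t = 0 both generators become projections of rank one, with
    B_0(sigma_1) B_0(sigma_2) = 0.  Among the words with both letters, only
    sigma_2 ^ p sigma_1 ^ q survives, as a nilpotent matrix. *)
Lemma burau_mx0 (K : comNzRingType) (s : seq bool) :
  [\/ s = [::], true \notin s /\ burau_mx (0 : K) s = mat2 0 1 0 1,
      false \notin s /\ burau_mx (0 : K) s = mat2 1 0 0 0
    | exists x, burau_mx (0 : K) s = mat2 0 x 0 0].
Proof.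
elim/last_ind: s => [|s b IH]; first by constructor 1.
rewrite burau_mx_rcons !mem_rcons !inE oppr0; case: IH => [->|[ts ->]|[fs ->]|[x ->]].
- by case: b; [constructor 3|constructor 2]; split => //;
    rewrite /burau_mx /= mat2_1 mul_mat2; congr mat2; ring.
- case: b; rewrite mul_mat2; last by constructor 2; split => //; congr mat2; ring.
  by constructor 4; exists 0; congr mat2; ring.
- case: b; rewrite mul_mat2; first by constructor 3; split => //; congr mat2; ring.
  by constructor 4; exists 1; congr mat2; ring.
- constructor 4; exists (if b then 0 else x).
  by case: b; rewrite mul_mat2; congr mat2; ring.
Qed.

(** This shows that the Alexander polynomial is not zero; for a power of one
    generator, whose closure is a split link, it is. *)
Lemma burau_det0 (K : fieldType) (s : seq bool) :
  true \in s -> false \in s -> burau_det (0 : K) s = 1.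
Proof.
move=> ts fs; have := burau_mx0 K s; rewrite ts fs.
case=> [s0|[]//|[]//|[x xE]]; first by rewrite s0 in ts.
by rewrite /burau_det det_subr1 xE det_mat2 !mxE /=; ring.
Qed.

Lemma leq_mup_map (F K : fieldType) (f : {rmorphism F -> K}) r (p : {poly F}) :
  p != 0 -> (mup r p <= mup (f r) (map_poly f p))%N.
Proof.
move=> p0; rewrite mup_geq ?map_poly_eq0 // -(map_polyX f) -map_polyC -rmorphB -rmorphXn.
by rewrite dvdp_map -mup_geq.
Qed.

Section Multiplicity.
Variable R : realType.
Local Notation C := R[i].

Definition burau_poly (s : seq bool) : {poly C} := burau_det 'X s.
Definition closing_poly (s : seq bool) : {poly R} := closing 'X s.

Lemma horner_burau_poly s (t : C) : (burau_poly s).[t] = burau_det t s.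
Proof. by rewrite -horner_evalE rmorph_burau_det /= /horner_eval hornerX. Qed.

Lemma horner_closing_poly s (y : R) : (closing_poly s).[y] = closing y s.
Proof. by rewrite -horner_evalE rmorph_closing /= /horner_eval hornerX. Qed.

Lemma horner_map_closing_poly s (y : C) :
  (map_poly (real_complex R) (closing_poly s)).[y] = closing y s.
Proof.
by rewrite rmorph_closing /= map_polyX -horner_evalE rmorph_closing /= /horner_eval hornerX.
Qed.

Lemma burau_poly_neq0 s : true \in s -> false \in s -> burau_poly s != 0.
Proof.
move=> ts fs; apply/eqP => /(congr1 (horner^~ 0)).
by rewrite horner_burau_poly burau_det0 // horner0 => /eqP; rewrite oner_eq0.
Qed.

Lemma closing_poly_neq0 s : true \in s -> false \in s -> closing_poly s != 0.
Proof.
move=> ts fs; apply/eqP => Q0.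
have P0 : burau_poly s \Po (- 'X^2) = 0.
  have ch0 : [pchar C] =i pred0 by exact: pchar_num.
  apply: (poly_eq_off0 ch0) => v v0; rewrite horner_comp !hornerE horner_burau_poly.
  have := burau_det_closing s v0; rewrite -(horner_map_closing_poly s) Q0 rmorph0 horner0.
  by rewrite mulr0 => /eqP; rewrite mulf_eq0 expf_eq0 pnatr_eq0 andbF => /eqP.
move: P0 => /(congr1 (horner^~ 0)).
rewrite horner_comp !hornerE horner_burau_poly /= expr0n oppr0 burau_det0 //.
by move=> /eqP; rewrite oner_eq0.
Qed.

(** The factor t ^ 2 + t + 1 and the powers of t do not vanish at [z]. *)
Lemma mult_alexander s (z : C) : burau_poly s != 0 ->
  z != 0 -> z ^+ 2 + z + 1 != 0 ->
  mult z (alexander (braid_of s)) = mup z (burau_poly s).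
Proof.
move=> P0 z0 zc.
have [p [k fp]] := laurent_numP (alexander (braid_of s)).
rewrite (Defs.multE z0 fp).
have E : p * ('X^2 + 'X + 1) = 'X^k * burau_det 'X s :> {poly int}.
  have /(congr1 val) := alexanderP (braid_of s).
  rewrite burau_braid_of -/(burau_det tvar s) => H.
  have {}H : val (alexander (braid_of s)) * (tofrac 'X ^+ 2 + tofrac 'X + 1) =
    burau_det (tofrac 'X) s.
    have -> // : burau_det (tofrac 'X) s = val (burau_det tvar s).
    by rewrite rmorph_burau_det.
  apply/eqP; rewrite -tofrac_eq tofracM -fp tofracM [tofrac (burau_det _ _)]rmorph_burau_det.
  by rewrite -H !rmorphD rmorph1 !rmorphXn /= mulrAC mulrC.
have := congr1 (fun q => mup z (map_poly (intr : int -> C) q)) E.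
rewrite !rmorphM !rmorphD rmorph1 /= !map_polyXn map_polyX mupMl; last first.
  by rewrite rootE !hornerE.
move=> ->; rewrite rmorph_burau_det /= map_polyX mupMr //.
by rewrite rootE hornerXn expf_neq0.
Qed.

Lemma sum_count_mem (T : eqType) (r zs : seq T) : uniq r -> {subset zs <= r} ->
  (\sum_(z <- r) count_mem z zs)%N = size zs.
Proof.
move=> ur; elim: zs => [|a zs IH] sub; first by rewrite big1.
rewrite /= big_split /= IH; last by move=> z zz; rewrite sub // inE zz orbT.
rewrite -[RHS]add1n; congr (_ + _)%N; have ar : a \in r by rewrite sub // mem_head.
rewrite (bigD1_seq a) //= eqxx big1 // => z /negbTE; by rewrite eq_sym => ->.
Qed.

Lemma nzeros_ge (S : set C) (f : laurent) (zs : seq C) :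
  (forall z, z \in zs -> S z /\ (count_mem z zs <= mult z f)%N) ->
  (size zs <= nzeros S f)%N.
Proof.
move=> H; have [p0|p0] := eqVneq (map_poly (intr : int -> C) (laurent_num f)) 0.
  case: zs H => // z zs /(_ z (mem_head _ _)) [_].
  rewrite /mult p0 /= eqxx add1n.
  have -> : mup z 0 = 0%N.
    by rewrite /mup; case: arg_maxnP => [|[i /=]]; rewrite ?size_poly0 ?dvdp0 //; case: i.
  by [].
have [r0 r0E] := closed_field_poly_normal (map_poly (intr : int -> C) (laurent_num f)).
pose r := undup [seq z <- r0 | `[< S z >]].
have mult0 z : z \notin r0 -> mult z f = 0%N.
  move=> zr; rewrite /mult mupNroot // r0E rootZ ?lead_coef_eq0 //.
  by rewrite root_prod_XsubC.
rewrite /nzeros (fsbigE r).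
- rewrite -(@sum_count_mem _ r zs) ?undup_uniq //.
    rewrite big_seq [X in (_ <= X)%N]big_seq_cond [X in (_ <= X)%N](eq_bigl (fun z => z \in r)).
      apply: leq_sum => z zr; have [/H[]//|/count_memPn->//] := boolP (z \in zs).
    move=> z /=; case: (boolP (z \in r)) => //=; rewrite mem_undup mem_filter.
    by move=> /andP[/asboolP Sz _]; apply: mem_set.
  move=> z zz; have [Sz cz] := H z zz; rewrite mem_undup mem_filter asboolT //=.
  apply/negPn/negP => /mult0 m0; move: cz; rewrite m0 leqn0 => /eqP/count_memPn.
  by rewrite zz.
- exact: undup_uniq.
- by move=> z /=; rewrite mem_undup mem_filter => /andP[/asboolP].
- move=> z Sz; rewrite mem_undup mem_filter asboolT //=; exact: mult0.
Qed.

(** The point t = - v ^ 2 of the unit circle where v + 1 / v = r and v has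
    nonpositive imaginary part. *)
Definition circle_point (r : R) : C :=
  Complex (1 - r ^+ 2 / 2) (r * Num.sqrt (1 - (r / 2) ^+ 2)).

Lemma circle_point_expi (theta : R) : - pi < theta < pi ->
  circle_point (2 * sin (theta / 2)) = expi theta.
Proof.
move=> /andP[t1 t2]; have c0 : 0 < cos (theta / 2).
  by apply: cos_gt0_pihalf; rewrite -mulNr !ltr_pM2r ?invr_gt0 // t1 t2.
have -> : expi theta = Complex (cos (theta / 2 *+ 2)) (sin (theta / 2 *+ 2)).
  by rewrite -mulr_natr divfK // pnatr_eq0.
rewrite cos_mulr2n sin_mulr2n /circle_point.
have -> : 2 * sin (theta / 2) / 2 = sin (theta / 2) by field.
rewrite -cos2sin2 sqrtr_sqr gtr0_norm // cos2sin2; congr Complex; first by field.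
by rewrite -mulr_natr; ring.
Qed.

Lemma half_lt1 (r : R) : - 2 < r < 2 -> 0 < 1 - (r / 2) ^+ 2.
Proof. by move=> /andP[r1 r2]; nra. Qed.

(** The first coordinate determines r ^ 2, the second the sign of r. *)
Lemma circle_point_inj (r r' : R) : - 2 < r < 2 -> - 2 < r' < 2 ->
  circle_point r = circle_point r' -> r = r'.
Proof.
move=> /half_lt1 h /half_lt1 h' [e1 e2].
have rr : r ^+ 2 = r' ^+ 2 by move: e1; lra.
have s : Num.sqrt (1 - (r / 2) ^+ 2) = Num.sqrt (1 - (r' / 2) ^+ 2).
  by congr Num.sqrt; rewrite !exprMn rr.
by move: e2; rewrite s; apply: mulIf; rewrite gt_eqF // sqrtr_gt0.
Qed.

Lemma circle_point_sqr (r : R) : - 2 < r < 2 ->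
  exists v : C, [/\ v != 0, v + v^-1 = r%:C%C & circle_point r = - v ^+ 2].
Proof.
move=> /half_lt1 h; pose c := Num.sqrt (1 - (r / 2) ^+ 2).
have c2 : c ^+ 2 = 1 - (r / 2) ^+ 2 by rewrite sqr_sqrtr // ltW.
have vV : (Complex (r / 2) (- c) : C) * Complex (r / 2) c = 1.
  apply/eqP; rewrite eq_complex /=; apply/andP; split; apply/eqP.
    by move: c2; rewrite !expr2; lra.
  by ring.
have v0 : (Complex (r / 2) (- c) : C) != 0.
  by apply/eqP => v0; move/eqP: vV; rewrite v0 mul0r eq_sym oner_eq0.
exists (Complex (r / 2) (- c)); split => //.
  rewrite (_ : _^-1 = Complex (r / 2) c); last by apply: (mulfI v0); rewrite vV mulfV.
  by apply/eqP; rewrite eq_complex /=; apply/andP; split; apply/eqP; field.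
apply/eqP; rewrite eq_complex /= -/c; apply/andP; split; apply/eqP.
  by move: c2; rewrite !expr2; lra.
by field.
Qed.

(** The exclusion of r ^ 2 = 3 discards the cube roots of unity:
    t ^ 2 + t + 1 = v ^ 2 ((v + 1 / v) ^ 2 - 3). *)
Lemma nzeros_root_list (S : set C) (s : seq bool) (rs : seq R) :
  true \in s -> false \in s -> root_list (closing_poly s) rs ->
  (forall r, r \in rs -> [/\ - 2 < r < 2, r ^+ 2 != 3 & S (circle_point r)]) ->
  (size rs <= nzeros S (alexander (braid_of s)))%N.
Proof.
move=> ts fs rl rsP; rewrite -(size_map circle_point); apply: nzeros_ge.
move=> _ /mapP[r rr ->]; have [r2 r3 Sr] := rsP r rr; split=> //.
have [v [v0 vr tv]] := circle_point_sqr r2.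
rewrite mult_alexander ?burau_poly_neq0 //; last 2 first.
- by rewrite tv oppr_eq0 expf_neq0.
- have -> : circle_point r ^+ 2 + circle_point r + 1 = v ^+ 2 * ((v + v^-1) ^+ 2 - 3).
    by rewrite tv; field.
  rewrite vr mulf_neq0 ?expf_neq0 // -rmorphXn -(rmorph_nat (real_complex R)) -rmorphB.
  by rewrite fmorph_eq0 subr_eq0.
rewrite count_map (@eq_in_count _ _ (pred1 r)); last first.
  move=> r' rr' /=; apply/eqP/eqP => [|->//].
  by have [r2' _ _] := rsP r' rr'; apply: circle_point_inj.
apply: leq_trans (rl r) _.
apply: leq_trans (leq_mup_map (real_complex R) r (closing_poly_neq0 ts fs)) _.
rewrite tv.
have ch0 : [pchar C] =i pred0 by exact: pchar_num.
have B0 := burau_poly_neq0 ts fs.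
have Q0 : map_poly (real_complex R) (closing_poly s) != 0.
  by rewrite map_poly_eq0 closing_poly_neq0.
have c0 : (2 : C) ^+ size s != 0 by rewrite expf_neq0 // pnatr_eq0.
have H (w : C) : w != 0 -> 2 ^+ size s * (burau_poly s).[- w ^+ 2] =
    w ^+ size s * (map_poly (real_complex R) (closing_poly s)).[w + w^-1].
  by move=> w0; rewrite horner_burau_poly horner_map_closing_poly burau_det_closing.
by have := mup_pullback ch0 B0 Q0 c0 v0 H; rewrite vr.
Qed.

End Multiplicity.

(** * The right arc: unitary matrices *)

Section Trig.
Variable R : realType.
Implicit Types x y theta r : R.

Lemma cheb_cos x n : cheb (2 * cos x) n = 2 * cos (n%:R * x).
Proof.
suff [] : cheb (2 * cos x) n = 2 * cos (n%:R * x) /\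
  cheb (2 * cos x) n.+1 = 2 * cos (n.+1%:R * x) by [].
elim: n => [|n [IH1 IH2]]; first by rewrite /= mul0r cos0 mul1r mulr1.
split=> //; rewrite chebSS IH1 IH2.
have -> : n.+2%:R * x = n.+1%:R * x + x by rewrite -[n.+2%:R]natr1; ring.
have -> : n%:R * x = n.+1%:R * x - x by rewrite -[n.+1%:R]natr1; ring.
by rewrite cosB cosD; ring.
Qed.

Lemma cos_natpi n : cos (n%:R * pi) = (-1) ^+ n :> R.
Proof.
by rewrite mulr_natl -[_ *+ n]add0r (alternatingn (@cosDpi R)) cos0 mulr1.
Qed.

(** From cos (3 x) = cos x (cos ^ 2 x - 3 sin ^ 2 x) at x = pi / 6. *)
Lemma cos_pi6_sqr : cos (pi / 6) ^+ 2 = 3 / 4 :> R.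
Proof.
set c := cos _; set s := sin (pi / 6 : R).
have p0 : 0 < pi :> R := pi_gt0 R.
have c0 : 0 < c by apply: cos_gt0_pihalf; apply/andP; split; lra.
have cs : c ^+ 2 + s ^+ 2 = 1 by exact: cos2Dsin2.
have : cos (pi / 2) = 0 :> R by exact: cos_pihalf.
have -> : pi / 2 = pi / 6 + (pi / 6 + pi / 6) :> R by field.
rewrite !(cosD, sinD) -/c -/s => H.
have {}H : c * (c ^+ 2 - 3 * s ^+ 2) = 0 by rewrite -H; ring.
move/eqP: H; rewrite mulf_eq0 (gt_eqF c0) /= => /eqP; lra.
Qed.

Lemma sin_pi3_sqr : sin (pi / 3) ^+ 2 = 3 / 4 :> R.
Proof.
have -> : pi / 3 = - (pi / 6) + pi / 2 :> R by field.
by rewrite sinDpihalf cosN cos_pi6_sqr.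
Qed.

Lemma ler_sin x y : - (pi / 2) <= x -> x <= y -> y <= pi / 2 -> sin x <= sin y.
Proof.
move=> x1; rewrite le_eqVlt => /orP[/eqP->//|xy] y1; apply/ltW.
rewrite ltr_sin ?in_itv //=.
  by rewrite x1 (le_trans (ltW xy)).
by rewrite y1 andbT (le_trans x1) ?ltW.
Qed.

Lemma circle_point_arc theta1 theta2 r : - pi < theta1 -> theta2 < pi ->
  theta1 <= theta2 ->
  2 * sin (theta1 / 2) <= r <= 2 * sin (theta2 / 2) ->
  exists theta, [/\ theta1 <= theta <= theta2, r = 2 * sin (theta / 2)
    & circle_point r = expi theta].
Proof.
move=> t1 t2 t12 /andP[r1 r2].
have rI : r / 2 \in `[-1, 1].
  by rewrite in_itv /=; have := sin_geN1 (theta1 / 2); have := sin_le1 (theta2 / 2);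
    move=> *; apply/andP; split; lra.
pose th := 2 * asin (r / 2).
have thr : r = 2 * sin (th / 2) by rewrite mulrAC divff // mul1r asinK //; field.
have th2 : - pi / 2 <= th / 2 <= pi / 2.
  rewrite mulrAC divff // mul1r mulNr; apply/andP.
  by split; [apply: asin_geNpi2|apply: asin_lepi2].
have [th_1|th_1] := leP theta1 th; last first.
  have : sin (th / 2) < sin (theta1 / 2).
    by rewrite ltr_sin ?in_itv /=; lra.
  by lra.
have [th_2|th_2] := leP th theta2; last first.
  have : sin (theta2 / 2) < sin (th / 2).
    by rewrite ltr_sin ?in_itv /=; lra.
  by lra.
exists th; split => //; first by rewrite th_1.
by rewrite {1}thr circle_point_expi // (lt_le_trans t1) //= (le_lt_trans th_2).
Qed.

End Trig.

Section DefiniteArc.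
Variable R : realType.

(** For y ^ 2 <= 3 the reduced norm is a sum of four nonnegative terms, one of
    which is the square of half the trace. *)
Lemma qa_le (y : R) s : y ^+ 2 <= 3 -> `|qa (qword y s)| <= 2 ^+ size s.
Proof.
move=> y3; have := qnorm y s; move: (qword y s) => [A B D E] /= H.
rewrite -ler_sqr ?nnegrE ?exprn_ge0 // real_normK ?num_real // exprAC.
have -> : 2 ^+ 2 = 4 :> R by ring.
by rewrite -H; have := sqr_ge0 B; have := sqr_ge0 D; have := sqr_ge0 E; nra.
Qed.

(** At these points the Chebyshev polynomial takes its extreme values 2 and - 2,
    which the trace cannot exceed. *)
Lemma closing_alternates (s : seq bool) (k : nat) :
  (0 < size s)%N -> let y : R := - 2 * cos (k%:R * pi / (size s)%:R) in
  y ^+ 2 <= 3 -> 0 <= (-1) ^+ (size s + k) * closing y s.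
Proof.
move=> s0 y y3; have n0 : (size s)%:R != 0 :> R by rewrite pnatr_eq0 -lt0n.
have : cheb y (size s) = (-1) ^+ (size s + k) * 2.
  rewrite /y mulNr chebN cheb_cos [_%:R * (_ / _)]mulrC divfK // cos_natpi exprD.
  by ring.
rewrite /closing => ->; rewrite mulrBr mulrCA mulrA -signr_odd.
have := qa_le s y3; rewrite ler_norml => /andP[].
by case: odd; rewrite ?expr0 ?expr1; lra.
Qed.

(** The points of the preceding lemma are 2 sin (theta / 2) for
    theta = 2 k pi / n - pi; those in the arc are indexed by the integers
    between n (pi + theta1) / (2 pi) and n (pi + theta2) / (2 pi). *)
Lemma right_arc_roots (s : seq bool) (theta1 theta2 : R) :
  (0 < size s)%N -> - (2 * pi / 3) < theta1 -> theta1 < theta2 ->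
  theta2 < 2 * pi / 3 ->
  exists rs, [/\ \prod_(r <- rs) ('X - r%:P) %| closing_poly R s,
    all (fun r => 2 * sin (theta1 / 2) <= r <= 2 * sin (theta2 / 2)) rs &
    (size s)%:R * ((theta2 - theta1) / (2 * pi)) - 2 <= (size rs)%:R].
Proof.
move=> s0 t1 t12 t2; set n := size s.
have n0 : 0 < n%:R :> R by rewrite ltr0n.
have p0 : 0 < pi :> R := pi_gt0 R.
pose u1 := n%:R * (pi + theta1) / (2 * pi); pose u2 := n%:R * (pi + theta2) / (2 * pi).
have u1E : u1 * (2 * pi) = n%:R * (pi + theta1) by rewrite divfK // mulf_neq0 ?gt_eqF.
have u2E : u2 * (2 * pi) = n%:R * (pi + theta2) by rewrite divfK // mulf_neq0 ?gt_eqF.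
have u10 : 0 <= u1 by rewrite divr_ge0 ?mulr_ge0 //; lra.
have u20 : 0 <= u2 by rewrite divr_ge0 ?mulr_ge0 //; lra.
pose K := (Num.truncn u1).+1; pose L := Num.truncn u2.
have K1 : u1 < K%:R by have /andP[] := truncn_itv u10.
have K2 : K%:R <= u1 + 1 by have /andP[] := truncn_itv u10; rewrite /K -natr1; lra.
have /andP[L1 L2] : L%:R <= u2 < L.+1%:R := truncn_itv u20.
have dE : n%:R * ((theta2 - theta1) / (2 * pi)) = u2 - u1.
  by rewrite /u1 /u2; move: (pi : R) (gt_eqF p0) => q /negbT q0; field.
have [KL|LK] := leqP K L; last first.
  exists [::]; split => //=; first by rewrite big_nil dvd1p.
  have : L.+1%:R <= K%:R :> R by rewrite ler_nat.
  by rewrite dE; lra.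
pose th k : R := k%:R * 2 * pi / n%:R - pi.
pose a k : R := - 2 * cos ((K + k)%:R * pi / n%:R).
have aE k : a k = 2 * sin (th (K + k)%N / 2).
  rewrite /a /th (_ : _ / 2 = (K + k)%:R * pi / n%:R - pi / 2); last by field; lra.
  by rewrite sinBpihalf; ring.
have thI k : (K <= k <= L)%N -> theta1 <= th k <= theta2.
  move=> /andP[]; rewrite -(ler_nat R) -(ler_nat R k) => Kk kL.
  rewrite /th lerBrDr lerBlDr ler_pdivlMr // ler_pdivrMr //.
  apply/andP; split; first by nra.
  by nra.
have [rs [srs rsI rsd]] : exists rs, [/\ size rs = (L - K)%N,
    all (fun r => a 0%N <= r <= a (L - K)%N) rs &
    \prod_(r <- rs) ('X - r%:P) %| ((-1) ^+ (n + K)) *: closing_poly R s].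
  apply: alternating_roots => k kLK.
    have kI : (K <= K + k <= L)%N by rewrite leq_addr /= -leq_subRL // ltnW.
    have kI' : (K <= K + k.+1 <= L)%N by rewrite leq_addr /= -leq_subRL.
    have /andP[x1 x2] := thI _ kI; have /andP[x3 x4] := thI _ kI'.
    rewrite !aE ltr_pM2l // ltr_sin ?in_itv /=; first last.
    - by apply/andP; split; lra.
    - by apply/andP; split; lra.
    rewrite ltr_pM2r ?invr_gt0 // ltrD2r ltr_pM2r ?invr_gt0 // ltr_pM2r //.
    by rewrite ltr_pM2r // ltr_nat addnS.
  have kI : (K <= K + k <= L)%N by rewrite leq_addr /= -leq_subRL.
  rewrite hornerZ mulrA -exprD addnC -addnA horner_closing_poly.
  apply: closing_alternates => //; rewrite -/(a k).
  have /andP[x1 x2] := thI _ kI.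
  have -> : 3 = (2 * sin (pi / 3)) ^+ 2 :> R by rewrite exprMn sin_pi3_sqr; field.
  rewrite aE !exprMn ler_pM2l ?exprn_gt0 // -[X in X <= _]real_normK ?num_real //.
  rewrite ler_pXn2r ?nnegrE ?normr_ge0 //; last by apply: sin_ge0_pi; apply/andP; split; lra.
  by rewrite ler_norml -sinN; apply/andP; split; apply: ler_sin; lra.
exists rs; split.
- by move: rsd; rewrite dvdpZr // signr_eq0.
- apply/allP => r /(allP rsI) /andP[r1 r2]; apply/andP; split.
    apply: le_trans r1; rewrite aE ler_pM2l // addn0.
    have /andP[x1 x2] := thI K (introT andP (conj (leqnn K) KL)).
    by apply: ler_sin; lra.
  apply: (le_trans r2); rewrite aE ler_pM2l // subnKC //.
  have /andP[x1 x2] := thI L (introT andP (conj KL (leqnn L))).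
  by apply: ler_sin; lra.
- by rewrite srs natrB // dE; move: L2; rewrite -natr1; lra.
Qed.

End DefiniteArc.

(** * The left arc: the angle of a real row vector *)

Section IndefiniteArc.
Variable R : realType.
Implicit Types (y : R) (s : seq bool) (b : bool).

(** The square root of y ^ 2 - 3 that splits the quaternion algebra. *)
Definition xi y : R := Num.sqrt (y ^+ 2 - 3).
(** The first row of the matrix of the word, scaled by 2 ^ n. *)
Definition row_fst y s : R := qa (qword y s) - xi y * qd (qword y s).
Definition row_snd y s : R := qb (qword y s) + xi y * qe (qword y s).

(** The angle by which the row vector turns under the letter [b]: the quotient
    of a cross product by a dot product.  The dot product is positive
    ([dot_gt0]), hence no branch of the angle has to be chosen. *)
Definition turn y s b : R :=
  atan ((row_fst y s * row_snd y (rcons s b) - row_snd y s * row_fst y (rcons s b)) /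
        (row_fst y s * row_fst y (rcons s b) + row_snd y s * row_snd y (rcons s b))).

Definition angle y s : R :=
  \sum_(i < size s) turn y (take i s) (nth false s i).

Lemma angle_rcons y s b : angle y (rcons s b) = angle y s + turn y s b.
Proof.
rewrite /angle size_rcons big_ord_recr /= nth_rcons ltnn eqxx -cats1 take_size_cat //.
congr (_ + _); apply: eq_bigr => i _.
by rewrite nth_cat ltn_ord takel_cat // ltnW.
Qed.

Lemma xi_sqr y : 3 <= y ^+ 2 -> xi y ^+ 2 = y ^+ 2 - 3.
Proof. by move=> y3; rewrite sqr_sqrtr // subr_ge0. Qed.

Lemma row_rcons y s b : 3 <= y ^+ 2 -> let e := (-1) ^+ b in
  row_fst y (rcons s b) = row_fst y s * (y - e * xi y) - row_snd y s /\
  row_snd y (rcons s b) = row_fst y s + row_snd y s * (y + e * xi y).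
Proof.
move=> /xi_sqr x2; rewrite /row_fst /row_snd qword_rcons /qstep /=.
move: (qword y s) (xi y) x2 => [A B D E] x x2 /=.
have -> : y ^+ 2 - 3 = x ^+ 2 by [].
by split; ring.
Qed.

Lemma xi_ge0 y : 0 <= xi y. Proof. exact: sqrtr_ge0. Qed.

Lemma xi_lt y : 0 < y -> 3 <= y ^+ 2 -> xi y < y.
Proof. by move=> y0 /xi_sqr; have := xi_ge0 y; nra. Qed.

Lemma dot_gt0 y s b : 0 < y -> 3 <= y ^+ 2 -> 0 < row_fst y s ^+ 2 + row_snd y s ^+ 2 ->
  0 < row_fst y s * row_fst y (rcons s b) + row_snd y s * row_snd y (rcons s b).
Proof.
move=> y0 y3; have [-> ->] := row_rcons s b y3; have := xi_lt y0 y3; have := xi_ge0 y.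
move: (row_fst y s) (row_snd y s) (xi y) => a c x x0 xy n0.
rewrite (_ : _ + _ = (y - (-1) ^+ b * x) * a ^+ 2 + (y + (-1) ^+ b * x) * c ^+ 2); last by ring.
have xa : 0 <= x * a ^+ 2 by rewrite mulr_ge0 ?sqr_ge0.
have xc : 0 <= x * c ^+ 2 by rewrite mulr_ge0 ?sqr_ge0.
have yx : 0 < (y - x) * (a ^+ 2 + c ^+ 2) by rewrite mulr_gt0 // subr_gt0.
by case: b; rewrite ?expr0 ?expr1; lra.
Qed.

(** The vector (a + i b) is multiplied at each step by
    (dot + i cross) / (a ^ 2 + b ^ 2), whose argument is the turn. *)
Lemma polar y s : 0 < y -> 3 <= y ^+ 2 ->
  exists2 rho, 0 < rho & row_fst y s = rho * cos (angle y s) /\ row_snd y s = rho * sin (angle y s).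
Proof.
move=> y0 y3; elim/last_ind: s => [|s b [rho r0 [aE bE]]].
  exists 1 => //; rewrite /angle big_ord0 cos0 sin0 /row_fst /row_snd /=; split; ring.
have n0 : 0 < row_fst y s ^+ 2 + row_snd y s ^+ 2.
  rewrite aE bE !exprMn -mulrDr cos2Dsin2 mulr1; nra.
have d0 := dot_gt0 b y0 y3 n0.
rewrite angle_rcons /turn.
set d := _ + _ in d0 *; set c := _ - _; set w := atan _.
have cw : 0 < cos w by rewrite /w cos_atan invr_gt0 sqrtr_gt0; nra.
have sw : sin w = c / d * cos w.
  by rewrite -(atanK (c / d)) -/w /tan divfK // gt_eqF.
exists (d / cos w / rho); first by rewrite !divr_gt0.
have rn : rho != 0 by rewrite gt_eqF.
have dn : d != 0 by rewrite gt_eqF.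
have cn : cos w != 0 by rewrite gt_eqF.
have r2 : rho ^+ 2 = row_fst y s ^+ 2 + row_snd y s ^+ 2.
  by rewrite aE bE !exprMn -mulrDr cos2Dsin2 mulr1.
rewrite cosD sinD sw.
have -> : cos (angle y s) = row_fst y s / rho by rewrite aE; field.
have -> : sin (angle y s) = row_snd y s / rho by rewrite bE; field.
have -> : d / cos w / rho * (row_fst y s / rho * cos w - row_snd y s / rho * (c / d * cos w)) =
  (d * row_fst y s - c * row_snd y s) / rho ^+ 2 by field; rewrite rn dn cn.
have -> : d / cos w / rho * (row_snd y s / rho * cos w + row_fst y s / rho * (c / d * cos w)) =
  (d * row_snd y s + c * row_fst y s) / rho ^+ 2 by field; rewrite rn dn cn.
by rewrite r2 /d /c; split; field; rewrite gt_eqF.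
Qed.

Lemma norm_gt0 y s : 0 < y -> 3 <= y ^+ 2 -> 0 < row_fst y s ^+ 2 + row_snd y s ^+ 2.
Proof.
move=> y0 y3; have [rho r0 [-> ->]] := polar s y0 y3.
by rewrite !exprMn -mulrDr cos2Dsin2 mulr1; nra.
Qed.

(** For a triangular matrix with diagonal a, d of determinant 1, one has
    a (C - a - d) = C a - a ^ 2 - 1, and this is at most - (`|a| - 1) ^ 2
    since the Chebyshev value C lies in [-2, 2]. *)
Lemma closing_sign y s : 0 < y -> 3 <= y ^+ 2 -> y ^+ 2 <= 4 -> row_snd y s = 0 ->
  row_fst y s * closing y s <= 0.
Proof.
move=> y0 y3 y4 b0.
have C2 : `|cheb y (size s)| <= 2.
  have -> : y = 2 * cos (acos (y / 2)) by rewrite acosK ?in_itv /=; [field | nra].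
  by rewrite cheb_cos normrM ger0_norm // ler_piMr // cos_max.
have := qnorm y s; rewrite -xi_sqr //; move: b0; rewrite /row_fst /row_snd /closing.
move: (qword y s) (xi y) C2 => [A B D E] x /= C2 b0 H.
have {b0}BE : B = - (x * E) by lra.
have e4 : 4 ^+ size s = (2 ^+ size s) ^+ 2 :> R by rewrite exprAC; congr (_ ^+ _); ring.
have {}H : (A - x * D) * (A + x * D) = (2 ^+ size s) ^+ 2 by rewrite -e4 -H BE; ring.
have c0 : 0 < 2 ^+ size s :> R by rewrite exprn_gt0.
move: C2 H; rewrite ler_norml; move: (cheb y _) (2 ^+ _) c0 => C c c0 /andP[C1 C2].
set a := A - x * D => H.
have -> : a * (c * C - 2 * A) = c * (C * a) - a ^+ 2 - a * (A + x * D) by rewrite /a; ring.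
rewrite H; have := sqr_ge0 (`|a| - c); rewrite sqrrB real_normK ?num_real //.
have := ler_norm a; have := ler_norm (- a); rewrite normrN => a1 a2.
have : C * a <= 2 * `|a| by nra.
by nra.
Qed.

Lemma continuous_qword s y :
  [/\ {for y, continuous (fun z : R => qa (qword z s))},
      {for y, continuous (fun z : R => qb (qword z s))},
      {for y, continuous (fun z : R => qd (qword z s))} &
      {for y, continuous (fun z : R => qe (qword z s))}].
Proof.
pose q := qword ('X : {poly R}) s.
have H (z : R) : qword z s = Quat (qa q).[z] (qb q).[z] (qd q).[z] (qe q).[z].
  by have /= := rmorph_qword (horner_eval z) 'X s; rewrite /horner_eval hornerX.
have C (p : {poly R}) (f : R -> R) : f =1 horner p -> {for y, continuous f}.
  by move=> /funext ->; exact: continuous_horner.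
by split; [apply: (C (qa q))|apply: (C (qb q))|apply: (C (qd q))|apply: (C (qe q))];
  move=> z; rewrite H.
Qed.

Lemma continuous_xi y : {for y, continuous xi}.
Proof.
apply: continuous_comp; last exact: sqrt_continuous.
by apply: cvgB; [apply: cvgM; exact: cvg_id | exact: cvg_cst].
Qed.

Lemma continuous_row_fst s y : {for y, continuous (fun z => row_fst z s)}.
Proof.
have [cA _ cD _] := continuous_qword s y.
by apply: cvgB => //; apply: cvgM => //; exact: continuous_xi.
Qed.

Lemma continuous_row_snd s y : {for y, continuous (fun z => row_snd z s)}.
Proof.
have [_ cB _ cE] := continuous_qword s y.
by apply: cvgD => //; apply: cvgM => //; exact: continuous_xi.
Qed.

Lemma continuous_angle s y : 0 < y -> 3 <= y ^+ 2 ->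
  {for y, continuous (fun z => angle z s)}.
Proof.
move=> y0 y3; elim/last_ind: s => [|s b IH].
  rewrite (_ : (fun z => _) = cst 0); first exact: cvg_cst.
  by apply/funext => z; rewrite /angle big_ord0.
rewrite (_ : (fun z => _) = (fun z => angle z s + turn z s b)); last first.
  by apply/funext => z; rewrite angle_rcons.
apply: cvgD => //; apply: continuous_comp; last exact: continuous_atan.
apply: cvgM.
  by apply: cvgB; apply: cvgM; (exact: continuous_row_fst || exact: continuous_row_snd).
apply: cvgV; first by rewrite gt_eqF // dot_gt0 // norm_gt0.
by apply: cvgD; apply: cvgM; (exact: continuous_row_fst || exact: continuous_row_snd).
Qed.

Lemma sqrt3_sqr : Num.sqrt 3 ^+ 2 = 3 :> R.
Proof. exact: sqr_sqrtr. Qed.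

Lemma sqrt3_gt0 : 0 < Num.sqrt 3 :> R.
Proof. by rewrite sqrtr_gt0. Qed.

(** For y = sqrt 3 the two generators become equal, since xi vanishes. *)
Lemma angle_sqrt3 s : angle (Num.sqrt 3) s = (size s)%:R * (pi / 6) :> R.
Proof.
elim/last_ind: s => [|s b IH]; first by rewrite /angle big_ord0 mul0r.
rewrite angle_rcons size_rcons -[(size s).+1%:R]natr1 mulrDl mul1r IH; congr (_ + _).
have y3 : 3 <= Num.sqrt 3 ^+ 2 :> R by rewrite sqrt3_sqr.
have n0 := norm_gt0 s sqrt3_gt0 y3.
rewrite /turn; have [-> ->] := row_rcons s b y3.
have -> : xi (Num.sqrt 3) = 0 :> R by rewrite /xi sqrt3_sqr subrr sqrtr0.
have s0 := sqrt3_gt0; have s2 := sqrt3_sqr.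
rewrite (_ : _ / _ = (Num.sqrt 3)^-1); last first.
  move: (Num.sqrt 3 : R) (row_fst _ _) (row_snd _ _) n0 s0 => r a c n0 r0.
  rewrite (_ : _ - _ = a ^+ 2 + c ^+ 2); last by ring.
  rewrite (_ : a * _ + _ = (a ^+ 2 + c ^+ 2) * r); last by ring.
  by rewrite invfM mulrA divff ?mul1r // gt_eqF.
have p0 : 0 < pi :> R := pi_gt0 R.
have pI : (pi / 6 : R) \in `](- (pi / 2)), (pi / 2)[.
  by rewrite in_itv /=; apply/andP; split; lra.
have c0 : 0 < cos (pi / 6) :> R by apply: cos_gt0_pihalf; apply/andP; split; lra.
have sn0 : 0 < sin (pi / 6) :> R by apply: sin_gt0_pihalf; apply/andP; split; lra.
rewrite -(tanK pI); congr atan; rewrite /tan.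
have c2 := @cos_pi6_sqr R; have sn2 : sin (pi / 6) ^+ 2 = 1 / 4 :> R.
  by rewrite sin2cos2 c2; field.
have sq (u v : R) : 0 < u -> 0 < v -> u ^+ 2 = v ^+ 2 -> u = v.
  by move=> u0 v0 /eqP; rewrite eqrXn2 ?ltW // => /eqP.
have -> : sin (pi / 6) = 1 / 2 :> R by apply: sq => //; rewrite sn2; field.
have -> : cos (pi / 6) = Num.sqrt 3 / 2 :> R.
  by apply: sq; rewrite ?divr_gt0 // c2 exprMn s2; field.
by field; rewrite gt_eqF.
Qed.

(** The points are found by repeated use of the intermediate value theorem, each
    one on the interval between sqrt 3 and its predecessor; in this way they
    come ordered. *)
Lemma angle_crossings s (k m : nat) :
  angle 2 s < k%:R * pi :> R ->
  (k + m)%:R * pi < (size s)%:R * (pi / 6) :> R ->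
  exists f : nat -> R, forall j, (j <= m)%N ->
    [/\ Num.sqrt 3 < f j < 2, angle (f j) s = (k + j)%:R * pi &
        ((j < m)%N -> f j.+1 < f j)].
Proof.
have s0 := sqrt3_gt0; have s2 := sqrt3_sqr.
have ivt (z v : R) : Num.sqrt 3 <= z -> z <= 2 -> angle z s < v -> v < (size s)%:R * (pi / 6) ->
    exists2 c, Num.sqrt 3 < c < z & angle c s = v.
  move=> z1 z2 v1 v2; have v2' : v < angle (Num.sqrt 3) s by rewrite angle_sqrt3.
  have [||c cI cv] := @IVT R (fun z => angle z s) (Num.sqrt 3) z v z1.
  - apply: continuous_in_subspaceT => c; rewrite inE /= in_itv /= => /andP[c1 c2].
    by apply: continuous_angle; nra.
  - by rewrite ge_min le_max (ltW v1) (ltW v2') orbT.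
  exists c => //; move: cI; rewrite in_itv /= !le_eqVlt => /andP[/orP[/eqP e|->] c2].
    by move: v2'; rewrite e cv ltxx.
  by case/orP: c2 => [/eqP e|->//]; move: v1; rewrite -e cv ltxx.
have s32 : Num.sqrt 3 < 2 :> R by nra.
move=> a2; elim: m => [|m IH] km.
  have [c cI cv] := ivt 2 (k%:R * pi) (ltW s32) (lexx _) a2 (ltac:(by rewrite addn0 in km)).
  exists (fun=> c) => j; rewrite leqn0 => /eqP->; by rewrite addn0.
have p0 : 0 < pi :> R := pi_gt0 R.
have [|f fP] := IH.
  by apply: lt_trans km; rewrite ltr_pM2r // ltr_nat addnS.
have [/andP[fm1 fm2] fm3 _] := fP m (leqnn m).
have [|c /andP[c1 c2] cv] := ivt (f m) ((k + m.+1)%:R * pi) (ltW fm1) (ltW fm2) _ km.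
  by rewrite fm3 ltr_pM2r // ltr_nat addnS.
exists (fun j => if (j <= m)%N then f j else c) => j jm.
have [jm'|mj] := leqP j m.
  have [f1 f2 f3] := fP j jm'; split=> // _; case: ltnP => [/f3//|mj].
  by rewrite (_ : j = m) //; apply/eqP; rewrite eqn_leq jm'.
have -> : j = m.+1 by apply/eqP; rewrite eqn_leq jm.
by split; rewrite ?ltnn // c1 (lt_trans c2).
Qed.

Lemma left_arc_roots s (k m : nat) :
  angle 2 s < k%:R * pi :> R ->
  (k + m)%:R * pi < (size s)%:R * (pi / 6) :> R ->
  exists rs, [/\ \prod_(r <- rs) ('X - r%:P) %| closing_poly R s,
    all (fun r => Num.sqrt 3 < r < 2) rs & size rs = m].
Proof.
move=> /angle_crossings H /H [f fP] {H}.
have s0 := sqrt3_gt0; have s2 := sqrt3_sqr.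
have [rs [srs rsI rsd]] : exists rs, [/\ size rs = m,
    all (fun r => f m <= r <= f 0%N) rs &
    \prod_(r <- rs) ('X - r%:P) %| ((-1) ^+ (k + m).+1) *: closing_poly R s].
  have [||rs [? rsI ?]] := @alternating_roots R m ((-1) ^+ (k + m).+1 *: closing_poly R s)
    (fun j => f (m - j)%N).
  - move=> j jm; have jm' : (m - j = (m - j.+1).+1)%N by rewrite subnSK.
    have [_ _] := fP (m - j.+1)%N (leq_subr _ _); rewrite jm'; apply.
    by rewrite -jm' leq_subr.
  - move=> j jm; set i := (m - j)%N; have im : (i <= m)%N by exact: leq_subr.
    have [/andP[y1 y2] th _] := fP i im.
    have y0 : 0 < f i by apply: lt_trans y1.
    have y3 : 3 <= f i ^+ 2 by nra.
    have y4 : f i ^+ 2 <= 4 by nra.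
    have [rho r0 [aE bE]] := polar s y0 y3.
    have cE : cos (angle (f i) s) = (-1) ^+ (k + i) by rewrite th cos_natpi.
    have b0 : row_snd (f i) s = 0.
      rewrite bE; have : sin (angle (f i) s) ^+ 2 = 0.
        by rewrite sin2cos2 cE sqrr_sign subrr.
      by move/eqP; rewrite expf_eq0 /= => /eqP->; rewrite mulr0.
    have := closing_sign y0 y3 y4 b0; rewrite aE cE -mulrA pmulr_rle0 // => cl.
    rewrite hornerZ mulrA -exprD horner_closing_poly.
    have -> : (j + (k + m).+1 = (k + i).+1 + j.*2)%N.
      by rewrite -(subnK jm) -/i -addnn; lia.
    by rewrite exprD -muln2 mulnC exprM sqrrN expr1n expr1n mulr1 exprS mulN1r mulNr oppr_ge0.
  - by exists rs; split => //; move: rsI; rewrite subnn subn0.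
exists rs; split => //.
- by move: rsd; rewrite dvdpZr // signr_eq0.
- apply/allP => r /(allP rsI) /andP[r1 r2].
  have [/andP[x1 x2] _ _] := fP m (leqnn m); have [/andP[x3 x4] _ _] := fP 0%N (leq0n m).
  by rewrite (lt_le_trans x1) // (le_lt_trans r2).
Qed.

End IndefiniteArc.

(** * Rotation at t = - 1 as a walk on stacks *)

(** A stack [u] of symbols encodes a direction in the closed first quadrant:
    [true] and [false] stand for the two shears that preserve the quadrant, and
    the empty stack for the vector (0, 1), which is fixed by the second shear;
    it behaves as an infinite stack of [false].  The natural number counts the
    quarter turns made so far.  A quarter turn exchanges the roles of the two
    generators, whence the parity.  One generator pushes [true]; the other one
    is the inverse of the shear [false]: it pops [false], and it carries a vector
    with top symbol [true] into the next quadrant. *)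
Definition walk_step (st : nat * seq bool) (b : bool) : nat * seq bool :=
  if b (+) odd st.1 then (st.1, true :: st.2) else
  match st.2 with
  | true :: u => (st.1.+1, false :: u)
  | false :: u => (st.1, u)
  | [::] => (st.1, [::])
  end.

(** The initial stack is that of (1, 1), the image of the row (1, 0) in the
    coordinates of [scaled_row2]. *)
Definition walk (s : seq bool) : nat * seq bool :=
  foldl walk_step (0%N, [:: true]) s.

Definition quarter_turns (s : seq bool) : nat := (walk s).1.

Lemma walk_rcons s b : walk (rcons s b) = walk_step (walk s) b.
Proof. by rewrite /walk -cats1 foldl_cat. Qed.

Section Cone.
Variable R : realType.
Implicit Types (s u : seq bool) (v : R * R).

Fixpoint cone_vec u : R * R :=
  match u with
  | [::] => (0, 1)
  | true :: u' => ((cone_vec u').1 + (cone_vec u').2, (cone_vec u').2)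
  | false :: u' => ((cone_vec u').1, (cone_vec u').1 + (cone_vec u').2)
  end.

Lemma cone_vec_ge0 u : 0 <= (cone_vec u).1 /\ 0 <= (cone_vec u).2.
Proof. by elim: u => [|[] u [IH1 IH2]] /=; split; rewrite ?addr_ge0. Qed.

(** The action of the generators at t = - 1 in the coordinates of
    [scaled_row2]. *)
Definition shear (b : bool) v : R * R :=
  if b then (v.1 + v.2, v.2) else (v.1, v.2 - v.1).

Definition quarter_rot v : R * R := (- v.2, v.1).

Lemma iter_quarter_rot_shear j b v :
  iter j quarter_rot (shear b v) = shear (b (+) odd j) (iter j quarter_rot v).
Proof.
elim: j => [|j IH]; first by rewrite addbF.
rewrite !iterS IH /=; move: (iter j quarter_rot v) => [p q].
by case: b {IH}; case: (odd j); rewrite /quarter_rot /=; congr pair; ring.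
Qed.

(** At t = - 1 the form a + b is fixed by sigma_1 and the form a - b by sigma_2,
    so that in these coordinates the generators are elementary matrices. *)
Definition scaled_row2 s : R * R :=
  ((row_fst 2 s + row_snd 2 s) / 2 ^+ size s, (row_fst 2 s - row_snd 2 s) / 2 ^+ size s).

Lemma xi2 : xi 2 = 1 :> R.
Proof. by rewrite /xi (_ : 2 ^+ 2 - 3 = 1) ?sqrtr1 //; ring. Qed.

Lemma scaled_row2_rcons s b : scaled_row2 (rcons s b) = shear b (scaled_row2 s).
Proof.
have y3 : 3 <= 2 ^+ 2 :> R by lra.
have n0 : 2 ^+ size s != 0 :> R by rewrite expf_neq0.
rewrite /scaled_row2; have [-> ->] := row_rcons s b y3; rewrite xi2 size_rcons exprS.
by case: b; rewrite /shear /= ?expr0 ?expr1; congr pair; field.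
Qed.

(** The stack describes the vector exactly, not only its direction. *)
Lemma scaled_row2_walk s : iter (walk s).1 quarter_rot (scaled_row2 s) = cone_vec (walk s).2.
Proof.
elim/last_ind: s => [|s b IH].
  by rewrite /scaled_row2 /row_fst /row_snd xi2 /=; congr pair; rewrite ?expr0; field.
rewrite scaled_row2_rcons walk_rcons /walk_step.
case: (walk s) IH => j u /= IH.
have := iter_quarter_rot_shear j b (scaled_row2 s); rewrite IH.
case: (b (+) odd j) => /= [->//|H].
case: u {IH} H => [|[] u] /= ->; rewrite /shear /quarter_rot /=.
- by congr pair; ring.
- by congr pair; ring.
- by rewrite [RHS]surjective_pairing; congr pair; ring.
Qed.

Lemma iter_quarter_rot_polar j (rho x : R) : iter j quarter_rot (rho * sin x, rho * cos x) =
  (rho * sin (x - j%:R * (pi / 2)), rho * cos (x - j%:R * (pi / 2))).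
Proof.
elim: j => [|j IH]; first by rewrite mul0r subr0.
rewrite iterS IH /quarter_rot /= -[j.+1%:R]natr1 [(_ + 1) * _]mulrDl mul1r opprD addrA.
by rewrite sinBpihalf cosBpihalf mulrN.
Qed.

(** The vector lies in the quadrant given by the stack, which determines the
    angle up to a multiple of 2 pi.  A single letter turns by less than pi / 2,
    so the angle cannot jump beyond this quadrant. *)
Lemma angle2_walk s : angle 2 s + pi / 4 - (quarter_turns s)%:R * (pi / 2) <= pi / 2 :> R.
Proof.
have p0 : 0 < pi :> R := pi_gt0 R.
have y0 : 0 < 2 :> R by [].
have y3 : 3 <= 2 ^+ 2 :> R by lra.
elim/last_ind: s => [|s b IH].
  by rewrite /angle big_ord0 /quarter_turns /= mul0r; lra.
set g := _ - _; have [//|gI] := leP g (pi / 2).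
have gpi : g < pi.
  have t2 : turn 2 s b < pi / 2 :> R by rewrite /turn atan_ltpi2.
  have : (quarter_turns s)%:R <= (quarter_turns (rcons s b))%:R :> R.
    rewrite ler_nat /quarter_turns walk_rcons /walk_step.
    by case: (walk s) => j u /=; case: (b (+) odd j) => //=; case: u => [|[] u] /=.
  by move: IH; rewrite /g angle_rcons; nra.
have cg : cos g < 0.
  have -> : g = g - pi / 2 + pi / 2 by ring.
  by rewrite cosDpihalf oppr_lt0 sin_gt0_pi //; apply/andP; split; lra.
have [rho r0 [aE bE]] := polar (rcons s b) y0 y3.
have sc : cos (pi / 4) = sin (pi / 4) :> R.
  by rewrite -[RHS]cosBpihalf (_ : pi / 4 - pi / 2 = - (pi / 4)) ?cosN //; lra.
have s0 : 0 < sin (pi / 4) :> R by apply: sin_gt0_pi; apply/andP; split; lra.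
have n0 : 0 < 2 ^+ size (rcons s b) :> R by rewrite exprn_gt0.
have := scaled_row2_walk (rcons s b); rewrite -/(quarter_turns _).
have -> : scaled_row2 (rcons s b) =
    (rho / sin (pi / 4) / 2 ^+ size (rcons s b) * sin (angle 2 (rcons s b) + pi / 4),
     rho / sin (pi / 4) / 2 ^+ size (rcons s b) * cos (angle 2 (rcons s b) + pi / 4)).
  rewrite /scaled_row2 aE bE sinD cosD sc.
  move: (sin (pi / 4)) (cos (angle _ _)) (sin (angle _ _)) (2 ^+ _) s0 n0 => w x1 x2 x3 w0 n0.
  by congr pair; field; rewrite !gt_eqF.
rewrite iter_quarter_rot_polar -/g => H.
have [_] := cone_vec_ge0 (walk (rcons s b)).2; rewrite -H /= pmulr_rge0.
  by rewrite leNgt cg.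
by rewrite !divr_gt0.
Qed.

End Cone.

Section Drift.
Variable R : realType.
Implicit Types (s u : seq bool).

(** The inverse of the golden ratio. *)
Definition golden : R := (Num.sqrt 5 - 1) / 2.

Lemma sqrt5_bounds :
  [/\ Num.sqrt 5 ^+ 2 = 5 :> R, 2 < Num.sqrt 5 :> R & Num.sqrt 5 < 7 / 3 :> R].
Proof.
have s2 : Num.sqrt 5 ^+ 2 = 5 :> R by exact: sqr_sqrtr.
have s0 : 0 < Num.sqrt 5 :> R by rewrite sqrtr_gt0.
by split => //; nra.
Qed.

Lemma golden_sqr : golden ^+ 2 = 1 - golden.
Proof. by have [s2 _ _] := sqrt5_bounds; rewrite /golden; move: s2; lra. Qed.

Lemma golden_bounds : 1 / 2 < golden < 2 / 3.
Proof. by have [_ s1 s2] := sqrt5_bounds; rewrite /golden; apply/andP; split; lra. Qed.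

(** The distribution function of a measure on the space of infinite stacks,
    shifted by - 1, in which [true] and [false] carry the weights 1 - golden and
    golden.  With these weights the measure, repeated in every quadrant, is
    stationary for the walk with inverse letters; this makes the level below grow
    at a constant mean rate.  The value at the empty stack is the fixed point of
    the last clause. *)
Fixpoint potential u : R :=
  match u with
  | [::] => - 1
  | true :: u' => (1 - golden) * potential u'
  | false :: u' => golden * potential u' - (1 - golden)
  end.

Lemma potential_bounds u : -1 <= potential u <= 0.
Proof.
have /andP[g1 g2] := golden_bounds.
by elim: u => [|[] u /andP[u1 u2]] /=; apply/andP; split; nra.
Qed.

Definition level (st : nat * seq bool) : R := st.1%:R + potential st.2.

(** The two possible steps are symmetric about the drift golden / 2, whatever
    the stack.  For u = true :: u' and u = false :: u' this is the relation
    golden ^ 2 = 1 - golden. *)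
Lemma level_walk_step st b : exists2 x, `|x| <= 1 &
  level (walk_step st b) = level st + golden / 2 + x /\
  level (walk_step st (~~ b)) = level st + golden / 2 - x.
Proof.
have g2 := golden_sqr; have /andP[g3 g4] := golden_bounds.
case: st => j u; rewrite /level /walk_step /= addNb.
pose d := - golden * potential u - golden / 2.
have d1 : `|d| <= 1.
  by have /andP[u1 u2] := potential_bounds u; rewrite ler_norml /d; apply/andP; split; nra.
have down : let st' := match u with
      | true :: u => (j.+1, false :: u) | false :: u => (j, u) | [::] => (j, [::]) end in
    st'.1%:R + potential st'.2 = j%:R + potential u + golden / 2 - d :> R.
  rewrite /d {d1 d}; case: u => [|[] u] /=.
  - by field.
  - by rewrite -[j.+1%:R]natr1; have := congr1 (fun z => z * potential u) g2; lra.
  - by have := congr1 (fun z => z * potential u) g2; lra.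
case: (b (+) odd j) => /=.
  by exists d => //; split => //; rewrite /d; field.
by exists (- d); rewrite ?normrN // opprK; split => //; rewrite /d; field.
Qed.

End Drift.

(** * Large deviations of the number of quarter turns *)

Fixpoint words (n : nat) : seq (seq bool) :=
  if n is m.+1 then [seq rcons s true | s <- words m] ++ [seq rcons s false | s <- words m]
  else [:: [::]].

Lemma mem_words s : s \in words (size s).
Proof.
elim/last_ind: s => [|s b IH] //.
by rewrite size_rcons /= mem_cat; apply/orP; case: b; [left|right]; apply/mapP; exists s.
Qed.

Lemma size_mem_words n s : s \in words n -> size s = n.
Proof.
elim: n s => [|n IH] s /=; first by rewrite inE => /eqP->.
by rewrite mem_cat => /orP[] /mapP[t /IH <- ->]; rewrite size_rcons.
Qed.

Section Tail.
Variable R : realType.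

Lemma sum_words (f : seq bool -> R) n :
  \sum_(s <- words n.+1) f s = \sum_(s <- words n) (f (rcons s true) + f (rcons s false)).
Proof. by rewrite /= big_cat !big_map big_split. Qed.

(** Used with x and - x, it replaces the usual bound on cosh: the sum of the two
    inverses is 2 / (1 - x ^ 2). *)
Lemma expR_le_inv (x : R) : x < 1 -> expR x <= (1 - x)^-1.
Proof.
move=> x1; rewrite -[x in expR x]opprK expRN lef_pV2 ?posrE ?expR_gt0 ?subr_gt0 //.
exact: expR_ge1Dx.
Qed.

(** The sum over words of length n is 2 ^ n times an expectation over a fair
    random word; each letter multiplies it by at most 2 / (1 - eta ^ 2). *)
Lemma exp_moment (eta : R) n : 0 <= eta < 1 ->
  \sum_(s <- words n) expR (eta * (level R (walk s) - n%:R * (golden R / 2)))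
   <= (2 / (1 - eta ^+ 2)) ^+ n.
Proof.
move=> /andP[e0 e1].
have D0 : 0 < 1 - eta ^+ 2 by nra.
elim: n => [|n IH].
  rewrite big_seq1 expr0 mul0r subr0 -expR0 ler_expR mulr_ge0_le0 //.
  rewrite /level /= add0r; have /andP[] := golden_bounds R; nra.
rewrite sum_words exprSr; apply: le_trans (ler_wpM2r _ IH); last first.
  by rewrite divr_ge0 // ltW.
rewrite mulr_suml; apply: ler_sum => s _.
set c := golden R / 2.
have [x x1 [xE1 xE2]] := level_walk_step R (walk s) true.
rewrite !walk_rcons xE1 xE2 -/c -[n.+1%:R]natr1.
have -> : eta * (level R (walk s) + c + x - (n%:R + 1) * c) =
  eta * (level R (walk s) - n%:R * c) + eta * x by ring.
have -> : eta * (level R (walk s) + c - x - (n%:R + 1) * c) =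
  eta * (level R (walk s) - n%:R * c) + - (eta * x) by ring.
rewrite !expRD -mulrDr ler_wpM2l ?expR_ge0 //.
have /andP[y1 y2] : - eta <= eta * x <= eta.
  by move: x1; rewrite ler_norml => /andP[x1 x2]; apply/andP; split; nra.
move: (eta * x) y1 y2 => y y1 y2.
apply: (@le_trans _ _ ((1 - y)^-1 + (1 - - y)^-1)).
  by rewrite lerD // expR_le_inv //; lra.
have -> : (1 - y)^-1 + (1 - - y)^-1 = 2 / (1 - y ^+ 2).
  by field; apply/andP; split; [|apply/andP; split]; rewrite gt_eqF //; nra.
by apply: ler_wpM2l => //; rewrite lef_pV2 ?posrE //; nra.
Qed.

(** The additive constant 1 absorbs the difference between the number of quarter
    turns and the level. *)
Definition fast (eps : R) (s : seq bool) : bool :=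
  (golden R / 2 + eps) * (size s)%:R + 1 <= (quarter_turns s)%:R.

(** Markov's inequality for the exponential moment with parameter eps / 2. *)
Lemma fast_tail (eps : R) : 0 < eps -> eps <= 1 ->
  exists2 r : R, 0 <= r < 1 & forall n, (count (fast eps) (words n))%:R <= (2 * r) ^+ n.
Proof.
move=> p0 p1; pose eta := eps / 2.
have eI : 0 <= eta < 1 by apply/andP; split; rewrite /eta; lra.
have /andP[e0 e1] := eI.
have D0 : 0 < 1 - eta ^+ 2 by nra.
have D1 : 0 < 1 + eta * eps by nra.
(* A letter costs a factor 1 - eta ^ 2 in the moment bound, and the deviation
   gains at least 1 + eta eps per letter. *)
exists ((1 - eta ^+ 2) * (1 + eta * eps))^-1.
  rewrite invr_ge0 mulr_ge0 ?(ltW D0) ?(ltW D1) //= invf_lt1 ?mulr_gt0 //.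
  have -> : eps = 2 * eta by rewrite /eta; field.
  have : 0 < eta by rewrite /eta; lra.
  have : eta <= 1 / 2 by rewrite /eta; lra.
  move: eta {eI D0 D1} e0 e1 => x x0 x1 x2 x3.
  have -> : (1 - x ^+ 2) * (1 + x * (2 * x)) = 1 + x ^+ 2 * (1 - 2 * x ^+ 2) by ring.
  by rewrite ltrDl mulr_gt0 ?exprn_gt0 //; nra.
move=> n; rewrite invfM mulrA exprMn exprVn ler_pdivlMr ?exprn_gt0 //.
apply: le_trans (exp_moment n eI).
rewrite -sum1_count natr_sum mulr_suml big_mkcond /=.
rewrite big_seq [leRHS]big_seq; apply: ler_sum => s /size_mem_words sn.
case: ifP => [|_]; last exact: expR_ge0.
rewrite /fast sn mul1r => fs.
apply: (@le_trans _ _ (expR (eta * eps) ^+ n)).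
  by rewrite lerXn2r ?nnegrE ?expR_ge0 ?(ltW D1) // expR_ge1Dx.
rewrite -expRM_natl ler_expR mulrCA ler_wpM2l //.
have /andP[u1 u2] := potential_bounds R (walk s).2.
by move: fs; rewrite /level -/(quarter_turns s); nra.
Qed.

End Tail.

(** * Almost sure behaviour of the random word *)

Lemma geometric_sum_le (R : realType) (r : R) n : 0 <= r < 1 ->
  \sum_(0 <= i < n) r ^+ i <= (1 - r)^-1.
Proof.
move=> /andP[r0 r1]; have d0 : 0 < 1 - r by rewrite subr_gt0.
rewrite -[leRHS]mul1r ler_pdivlMr // mulrC.
have -> : (1 - r) * \sum_(0 <= i < n) r ^+ i = 1 - r ^+ n.
  elim: n => [|n IH]; first by rewrite big_geq // mulr0 expr0 subrr.
  by rewrite big_nat_recr //= mulrDr IH exprS; ring.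
by rewrite gerBl exprn_ge0.
Qed.

Section Probability.
Context (d : measure_display) (Omega : measurableType d) (R : realType)
  (P : probability Omega R).

Lemma borel_cantelli_geometric (A : (set Omega)^nat) (C r : R) :
  (forall n, measurable (A n)) -> 0 <= r < 1 ->
  (forall n, (P (A n) <= (C * r ^+ n)%:E)%E) ->
  {ae P, forall omega, exists N, forall n, (N <= n)%N -> ~ A n omega}.
Proof.
move=> mA rI PA; have /andP[r0 r1] := rI.
have C0 : 0 <= C.
  have := le_trans (measure_ge0 P (A 0%N)) (PA 0%N).
  by rewrite lee_fin expr0 mulr1.
have H : P (lim_sup_set A) = 0%E.
  apply: lim_sup_set_cvg0 => //.
  apply: (@le_lt_trans _ _ (C * (1 - r)^-1)%:E); last exact: ltry.
  apply: lime_le; first exact: is_cvg_nneseries.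
  apply: nearW => n; apply: (@le_trans _ _ (\sum_(0 <= i < n) (C * r ^+ i)%:E)%E).
    by apply: lee_sum => i _; exact: PA.
  by rewrite sumEFin lee_fin -mulr_sumr ler_wpM2l // geometric_sum_le.
exists (lim_sup_set A); split => //.
  by apply: bigcap_measurable => // k _; exact: bigcup_measurable.
move=> omega /= nE n _ ; apply: contrapT => nA; apply: nE; exists n => k nk Ak.
by apply: nA; exists k.
Qed.

Variable g : nat -> {RV P >-> Br3}.
Hypothesis g_indep : mutually_independent g.
Hypothesis g_unif : forall i : nat, uniform_pair sigma1 sigma2 (g i).

Lemma prob_step i b : P (g i @^-1` [set sigma b]) = (2^-1)%:E.
Proof. by have [H1 H2] := g_unif i; case: b. Qed.

Lemma measurable_step i (B : set Br3) : measurable (g i @^-1` B).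
Proof. by rewrite -[X in measurable X]setTI; exact: (measurable_funP (g i)). Qed.

Definition cylinder (s : seq bool) : set Omega :=
  \bigcap_(i in [set` [fset k in iota 0 (size s)]%fset])
    (g i @^-1` [set sigma (nth false s i)]).

Lemma cylinderP s omega : cylinder s omega <->
  forall i, (i < size s)%N -> g i omega = sigma (nth false s i).
Proof.
split=> [H i si|H i /=].
  by apply: (H i); rewrite /= inE mem_iota add0n.
by rewrite inE mem_iota add0n; exact: H.
Qed.

Lemma measurable_cylinder s : measurable (cylinder s).
Proof.
apply: fin_bigcap_measurable => [|i _]; first exact: finite_fset.
exact: measurable_step.
Qed.

Lemma prob_cylinder s : P (cylinder s) = (2^-1 ^+ size s)%:E.
Proof.
rewrite [LHS](g_indep _ (A := fun i => [set sigma (nth false s i)])) //.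
under eq_bigr do rewrite prob_step.
have H (r : seq nat) : (\prod_(i <- r) (2^-1 : R)%:E = (2^-1 ^+ size r)%:E)%E.
  elim: r => [|i r IH]; first by rewrite big_nil.
  by rewrite big_cons IH -EFinM exprS.
by rewrite H -/(#|`_|) card_fseq undup_id ?iota_uniq // size_iota.
Qed.

(** The event is the union of the cylinders of the bad words of length n, of
    probability at most C r ^ n; then Borel-Cantelli applies. *)
Lemma rare_words (bad : pred (seq bool)) (C r : R) : 0 <= r < 1 ->
  (forall n, (count bad (words n))%:R <= C * (2 * r) ^+ n) ->
  {ae P, forall omega, exists N, forall s, (N <= size s)%N -> cylinder s omega -> ~~ bad s}.
Proof.
move=> rI cnt.
pose A n := \big[setU/set0]_(s <- words n | bad s) cylinder s.
have mA n : measurable (A n).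
  by apply: bigsetU_measurable => s _; exact: measurable_cylinder.
have PA n : (P (A n) <= (C * r ^+ n)%:E)%E.
  have : (P (A n) <= ((count bad (words n))%:R * 2^-1 ^+ n)%:E)%E.
    rewrite /A; have : {subset words n <= words n} by [].
    elim: {1 3 4}(words n) => [|s l IH] sub.
      by rewrite big_nil measure0 mul0r.
    have {}IH := IH (fun t tl => sub t (mem_behead (s := s :: l) tl)).
    rewrite big_cons /=; case: ifP => // _.
    apply: le_trans (measureU2 _ _ _) _; first exact: measurable_cylinder.
      by apply: bigsetU_measurable => t _; exact: measurable_cylinder.
    rewrite natrD mulrDl EFinD mul1r; apply: leeD => //.
    by rewrite [leLHS]prob_cylinder (size_mem_words (sub s (mem_head _ _))).
  move=> /le_trans -> //; rewrite lee_fin.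
  have := ler_wpM2r (exprn_ge0 n (ltac:(by rewrite invr_ge0) : 0 <= (2^-1 : R))) (cnt n).
  by rewrite -mulrA -exprMn mulrAC divff // mul1r.
apply: filterS (borel_cantelli_geometric mA rI PA) => omega [N NP].
exists N => s Ns cs; apply/negP => bs; apply: (NP _ Ns).
by rewrite /A -bigcup_seq_cond; exists s => //=; rewrite mem_words.
Qed.

Lemma steps_generators : {ae P, forall omega, forall i, exists b, g i omega = sigma b}.
Proof.
apply: ae_foralln => i.
pose B b := g i @^-1` [set sigma b].
have mB b : measurable (B b) by exact: measurable_step.
have PB : P (B true `|` B false) = 1%E.
  rewrite measureU //; last first.
    apply/seteqP; split => // omega [] /= e1 e2; case: sigma1_neq_sigma2.
    by rewrite -[sigma1]e2 -[sigma2]e1.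
  rewrite [X in (X + _)%E](prob_step i true) [X in (_ + X)%E](prob_step i false).
  by rewrite -EFinD; congr EFin; field.
have PC : P (~` (B true `|` B false)) = 0%E.
  by rewrite probability_setC ?PB ?subee //; exact: measurableU.
exists (~` (B true `|` B false)); split.
- by apply: measurableC; exact: measurableU.
- exact: PC.
- by move=> omega /= nE [] /= H; apply: nE; [exists true|exists false].
Qed.

Lemma count_constant n :
  (count (fun s => (true \notin s) || (false \notin s)) (words n) <= 2)%N.
Proof.
have H b : count (fun s => b \notin s) (words n) = 1%N.
  elim: n => [|n IH] //=.
  rewrite count_cat !count_map -[RHS]IH; case: b {IH}.
    rewrite (@eq_count _ _ pred0) ?count_pred0; last by move=> s /=; rewrite mem_rcons inE.
    by apply: eq_count => s /=; rewrite mem_rcons inE.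
  rewrite [X in (_ + X)%N](@eq_count _ _ pred0) ?count_pred0; last first.
    by move=> s /=; rewrite mem_rcons inE.
  by rewrite addn0; apply: eq_count => s /=; rewrite mem_rcons inE.
rewrite -[2%N]/(1 + 1)%N -{1}(H true) -(H false) -count_predUI.
by apply: leq_trans (leq_addr _ _); apply/eq_leq/eq_count => s.
Qed.

Lemma almost_sure_words : {ae P, forall omega, exists b : nat -> bool,
  [/\ forall n, braid_walk g n omega = braid_of (mkseq b n),
    forall k, exists N, forall n, (N <= n)%N -> ~~ fast (k.+1%:R^-1 : R) (mkseq b n) &
    exists N, forall n, (N <= n)%N -> (true \in mkseq b n) && (false \in mkseq b n)]}.
Proof.
have rare1 : {ae P, forall omega, forall k, exists N, forall s, (N <= size s)%N ->
    cylinder s omega -> ~~ fast (k.+1%:R^-1 : R) s}.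
  apply: ae_foralln => k.
  have [||r rI cnt] := @fast_tail R k.+1%:R^-1.
  - by rewrite invr_gt0.
  - by rewrite invf_le1 // ler1n.
  by apply: (@rare_words _ 1 r) => // n; rewrite mul1r.
have rare2 : {ae P, forall omega, exists N, forall s, (N <= size s)%N ->
    cylinder s omega -> ~~ ((true \notin s) || (false \notin s))}.
  apply: (@rare_words _ 2 2^-1); first by apply/andP; split; lra.
  by move=> n; rewrite divff // expr1n mulr1 ler_nat count_constant.
move: rare1 rare2 steps_generators; apply: filterS3 => omega H1 [N2 H2] H3.
have [b bE] := choice H3.
have cyl n : cylinder (mkseq b n) omega.
  by apply/cylinderP => i; rewrite size_mkseq => si; rewrite nth_mkseq.
exists b; split.
- move=> n; rewrite /braid_walk /braid_of big_map.
  rewrite -(big_mkord xpredT (fun i => g i omega)) /index_iota subn0.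
  by apply: eq_bigr => i _.
- move=> k; have [N NP] := H1 k; exists N => n Nn.
  by apply: NP; rewrite ?size_mkseq.
- exists N2 => n Nn; have := H2 (mkseq b n); rewrite size_mkseq => /(_ Nn (cyl n)).
  by rewrite negb_or !negbK.
Qed.

End Probability.

(** * Zero densities *)

Section Density.
Variable R : realType.
Implicit Types (r y : R) (s : seq bool).

(** A bounded error in the number of zeros is invisible in the density. *)
Lemma zero_density_ge (S : set R[i]) (w : nat -> Br3) (a C : R) :
  (forall e, 0 < e -> exists N, forall n, (N <= n)%N ->
     n%:R * (a - e) - C <= (nzeros S (alexander (w n)))%:R) ->
  (a%:E <= zero_density S w)%E.
Proof.
move=> H; apply/lee_subgt0Pr => e e0; rewrite -EFinB /zero_density limn_einf_lim.
apply: lime_ge; first exact: is_cvg_einfs.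
have e2 : 0 < e / 2 by rewrite divr_gt0.
have [N NP] := H _ e2.
pose M := maxn N (Num.truncn (`|C| / (e / 2))).+1.
exists M => // m /= Mm; apply: le_ereal_inf_tmp => _ [n /= mn <-]; rewrite lee_fin.
have Nn : (N <= n)%N by apply: leq_trans mn; apply: leq_trans Mm; exact: leq_maxl.
have Cn : `|C| / (e / 2) < n%:R.
  have : ((Num.truncn (`|C| / (e / 2))).+1 <= n)%N.
    by apply: leq_trans mn; apply: leq_trans Mm; exact: leq_maxr.
  rewrite -(ler_nat R); apply: lt_le_trans.
  by have /andP[] := truncn_itv (divr_ge0 (normr_ge0 C) (ltW e2)).
have n0 : 0 < n%:R :> R by apply: le_lt_trans Cn; rewrite divr_ge0 // ltW.
rewrite ler_pdivlMr //; apply: le_trans (NP n Nn).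
move: Cn; rewrite ltr_pdivrMr // => Cn; have := ler_norm C; nra.
Qed.

(** The polynomial is even or odd in y; this is the symmetry t -> 1 / t of the
    Alexander polynomial, which exchanges the two halves of the left arc. *)
Lemma mup_closing_opp s r : closing_poly R s != 0 ->
  (mup r (closing_poly R s) <= mup (- r) (closing_poly R s))%N.
Proof.
move=> Q0; rewrite mup_geq //.
have : ('X - r%:P) ^+ mup r (closing_poly R s) %| closing_poly R s by rewrite -mup_geq.
move: (mup _ _) => k /(dvdp_comp_poly (- 'X)).
have -> : closing_poly R s \Po - 'X = (-1) ^+ size s *: closing_poly R s.
  rewrite -[LHS]/(comp_poly (- 'X) (closing 'X s)) rmorph_closing /= comp_polyX closingN.
  rewrite -signr_odd -[in RHS]signr_odd; case: odd; rewrite ?expr0 ?expr1.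
    by rewrite mulN1r scaleN1r.
  by rewrite mul1r scale1r.
rewrite dvdpZr ?signr_eq0 // rmorphXn rmorphB /= comp_polyX comp_polyC.
have -> : - 'X - r%:P = -1 *: ('X - (- r)%:P) :> {poly R}.
  by rewrite scaleN1r polyCN opprK opprD.
by rewrite exprZn dvdpZl // signr_eq0.
Qed.

Lemma expi_norm (theta : R) : `|expi theta| = 1.
Proof. by rewrite normc_def /= cos2Dsin2 sqrtr1. Qed.

Lemma circle_point_asin r : -2 < r < 2 -> circle_point r = expi (2 * asin (r / 2)).
Proof.
move=> /andP[r1 r2].
have rI : r / 2 \in `[-1, 1] by rewrite in_itv /=; apply/andP; split; lra.
have a1 : - (pi / 2) < asin (r / 2) by apply: asin_gtNpi2; apply/andP; split; lra.
have a2 : asin (r / 2) < pi / 2 by apply: asin_ltpi2; apply/andP; split; lra.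
rewrite -circle_point_expi; last by apply/andP; split; lra.
congr circle_point; rewrite [2 * asin _]mulrC mulfK ?pnatr_eq0 // asinK //; by field.
Qed.

(** The opposite root corresponds to the angle - theta, which has to be replaced
    by 2 pi - theta in order to be within pi / 3 of pi. *)
Lemma circle_point_arcL r : Num.sqrt 3 < r -> r < 2 ->
  arcL R (circle_point r) /\ arcL R (circle_point (- r)).
Proof.
move=> r1 r2; have p0 := pi_gt0 R; have s0 := sqrt3_gt0 R; have s2 := sqrt3_sqr R.
have rI : r / 2 \in `[-1, 1] by rewrite in_itv /=; apply/andP; split; lra.
have a2 : asin (r / 2) < pi / 2 by apply: asin_ltpi2; apply/andP; split; lra.
have sp0 : 0 < sin (pi / 3) :> R by apply: sin_gt0_pi; apply/andP; split; lra.
have sp2 := sin_pi3_sqr R.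
have a1 : pi / 3 < asin (r / 2).
  rewrite ltNge; apply/negP => le3.
  have : sin (asin (r / 2)) <= sin (pi / 3).
    apply: ler_sin => //; last by lra.
    by apply: asin_geNpi2; apply/andP; split; lra.
  rewrite asinK // => h; nra.
split.
  exists (2 * asin (r / 2)); last by rewrite circle_point_asin //; apply/andP; split; lra.
  by rewrite /= ltr_norml; apply/andP; split; lra.
exists (2 * pi - 2 * asin (r / 2)).
  by rewrite /= ltr_norml; apply/andP; split; lra.
rewrite circle_point_asin; last by apply/andP; split; lra.
have -> : asin (- r / 2) = - asin (r / 2).
  rewrite mulNr -[LHS]sinK; last first.
    rewrite in_itv /=; apply/andP.
    by split; [apply: asin_geNpi2|apply: asin_lepi2]; apply/andP; split; lra.
  rewrite asinK; last by rewrite in_itv /=; apply/andP; split; lra.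
  rewrite -{1}[r / 2]asinK // -sinN sinK // in_itv /=; apply/andP; split; lra.
rewrite /expi mulrN addrC -[2 * pi]mulrC mulr_natr; congr Complex.
  exact: cosD2pi.
exact: sinD2pi.
Qed.

Lemma right_arc_zeros s (theta1 theta2 : R) : true \in s -> false \in s ->
  - (2 * pi / 3) < theta1 -> theta1 < theta2 -> theta2 < 2 * pi / 3 ->
  exists rs, [/\ root_list (closing_poly R s) rs,
    forall r, r \in rs -> [/\ -2 < r < 2, r ^+ 2 < 3 &
      exists2 theta, theta1 <= theta <= theta2 & expi theta = circle_point r] &
    (size s)%:R * ((theta2 - theta1) / (2 * pi)) - 2 <= (size rs)%:R].
Proof.
move=> ts fs t1 t12 t2; have p0 := pi_gt0 R.
have s0 : (0 < size s)%N by case: s ts {fs}.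
have [rs [rsd rsI rss]] := right_arc_roots s0 t1 t12 t2.
exists rs; split => //; first by apply: root_list_dvdp; rewrite ?closing_poly_neq0.
have sp0 : 0 < sin (pi / 3) :> R by apply: sin_gt0_pi; apply/andP; split; lra.
have sp2 := sin_pi3_sqr R.
move=> r /(allP rsI) rI.
have [||th [thI rE cE]] := circle_point_arc _ _ (ltW t12) rI; [lra|lra|].
have /andP[th1 th2] := thI.
have r1 : sin (th / 2) < sin (pi / 3).
  by rewrite ltr_sin ?in_itv /=; lra.
have r2 : - sin (pi / 3) < sin (th / 2).
  by rewrite -sinN ltr_sin ?in_itv /=; lra.
split; first by apply/andP; split; nra.
  by rewrite rE; nra.
by exists th.
Qed.

Definition left_density : R := (7 - 3 * Num.sqrt 5) / 12.

(** With J quarter turns, the angle at t = - 1 is at most pi / 4 + J pi / 2, so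
    the multiples k pi with J / 2 + 1 / 4 < k < n / 6 are crossed.  The constant
    5 collects the roundings on both halves of the arc. *)
Lemma left_arc_zeros s (eps : R) : true \in s -> false \in s -> ~~ fast eps s ->
  exists rs, [/\ root_list (closing_poly R s) rs,
    forall r, r \in rs -> [/\ -2 < r < 2, 3 < r ^+ 2 & arcL R (circle_point r)] &
    (size s)%:R * (left_density - eps) - 5 <= (size rs)%:R].
Proof.
move=> ts fs; rewrite /fast -ltNge => J1.
have s0 := sqrt3_gt0 R; have s2 := sqrt3_sqr R; have p0 := pi_gt0 R.
have Q0 := closing_poly_neq0 R ts fs.
have n0 : (0 < size s)%N by case: (s) ts.
set J := quarter_turns s in J1; set n := size s in J1 n0 *.
(* h pi is the largest multiple of pi strictly below n pi / 6. *)
pose k := (J./2).+1; pose h := (n.-1 %/ 6)%N.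
have kJ1 : (J.+1 <= k.*2)%N by rewrite /k; have := odd_double_half J; lia.
have kJ2 : (k.*2 <= J.+2)%N by rewrite /k; have := odd_double_half J; lia.
have h1 : (h * 6 < n)%N by rewrite /h; lia.
have h2 : (n <= h * 6 + 6)%N by rewrite /h; lia.
have {}kJ1 : J%:R + 1 <= 2 * k%:R :> R by rewrite natr1 -natrM mul2n ler_nat.
have {}kJ2 : 2 * k%:R <= J%:R + 2 :> R by rewrite -natrD -natrM mul2n addn2 ler_nat.
have {}h2 : n%:R <= h%:R * 6 + 6 :> R by rewrite -natrM -natrD ler_nat.
have {}h1 : h%:R * 6 < n%:R :> R by rewrite -natrM ltr_nat.
have dE : left_density = 1 / 3 - golden R / 2 by rewrite /left_density /golden; field.
have big : n%:R * (left_density - eps) - 5 <= 2 * (h%:R - k%:R).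
  rewrite dE; nra.
have [kh|hk] := leqP k h; last first.
  exists [::]; split => //=.
  apply: le_trans big _; rewrite pmulr_rle0 // subr_le0 ler_nat; exact: ltnW.
have [rs [rsd rsI rss]] : exists rs, [/\ \prod_(r <- rs) ('X - r%:P) %| closing_poly R s,
    all (fun r => Num.sqrt 3 < r < 2) rs & size rs = (h - k)%N].
  apply: (@left_arc_roots R s k).
    by have := angle2_walk R s; rewrite -/J => a2; nra.
  by rewrite subnKC // -/n; nra.
have rl := root_list_dvdp Q0 rsd.
exists (rs ++ [seq - r | r <- rs]); split.
- apply: root_list_cat => //.
    move=> r /(allP rsI) /andP[r1 _] /mapP[r' /(allP rsI) /andP[r1' _] rE]; lra.
  move=> r; rewrite count_map (@eq_count _ _ (pred1 (- r))); last first.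
    by move=> r' /=; rewrite eqr_oppLR.
  by apply: leq_trans (rl _) _; rewrite -{2}[r]opprK mup_closing_opp.
- move=> r; rewrite mem_cat => /orP[/(allP rsI)|/mapP[r' /(allP rsI) + ->]] => /andP[r1 r2];
    have [A1 A2] := circle_point_arcL r1 r2.
    by split => //; [apply/andP; split; lra|nra].
  by split => //; [apply/andP; split; lra|nra].
- rewrite size_cat size_map rss natrD natrB //; lra.
Qed.

Lemma circle_point_S1 r : -2 < r < 2 -> S1 R (circle_point r).
Proof. by move=> r2; rewrite circle_point_asin //=; exact: expi_norm. Qed.

End Density.

Theorem corollary1p6 (R : realType) (d : measure_display)
  (Omega : measurableType d) (P : probability Omega R)
  (g : nat -> {RV P >-> Br3})
  (g_indep : mutually_independent g)
  (g_unif : forall i : nat, uniform_pair sigma1 sigma2 (g i)) :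
  {ae P, forall omega : Omega,
    let w := fun n : nat => braid_walk g n omega in
    (((((5 - Num.sqrt 5) / 4)%:E <= zero_density (S1 R) w)%E /\
      (2 / 3 < (5 - Num.sqrt 5) / 4 :> R)) /\
     ((((7 - 3 * Num.sqrt 5) / 12)%:E <= zero_density (closed_arcL R) w)%E /\
      (0 < (7 - 3 * Num.sqrt 5) / 12 :> R))) /\
    ((forall theta1 theta2 : R,
        0 <= theta1 -> theta1 < theta2 -> theta2 < 2 * pi / 3 ->
        (((theta2 - theta1) / (2 * pi))%:E <=
         zero_density [set expi theta | theta in `[theta1, theta2]] w)%E) /\
     ((2 / 3)%:E <= zero_density (arcR R) w)%E)}.
Proof.
apply: filterS (almost_sure_words g_indep g_unif) => omega [b [bE slow [N0 both]]].
set w := (fun n : nat => braid_walk g n omega).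
have p0 := pi_gt0 R; have [_ q1 q2] := sqrt5_bounds R.
have wE n : w n = braid_of (mkseq b n) by exact: bE.
have slow' (e : R) : 0 < e -> exists N, forall n, (N <= n)%N -> ~~ fast e (mkseq b n).
  move=> e0; have eV : 0 < e^-1 by rewrite invr_gt0.
  have [N NP] := slow (Num.truncn e^-1).
  exists N => n /NP; apply: contra; rewrite /fast; apply: le_trans.
  rewrite lerD2r ler_wpM2r // lerD2l invf_ple ?posrE // ltW //.
  by have /andP[] := truncn_itv (ltW eV).
have arc (S : set R[i]) theta1 theta2 n : (N0 <= n)%N ->
    - (2 * pi / 3) < theta1 -> theta1 < theta2 -> theta2 < 2 * pi / 3 ->
    (forall theta, theta1 <= theta <= theta2 -> S (expi theta)) ->
    n%:R * ((theta2 - theta1) / (2 * pi)) - 2 <= (nzeros S (alexander (w n)))%:R.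
  move=> /both /andP[ts fs] t1 t12 t2 sub.
  have [rs [rl rsP]] := right_arc_zeros ts fs t1 t12 t2; rewrite size_mkseq => /le_trans; apply.
  rewrite ler_nat wE; apply: nzeros_root_list => // r /rsP[r1 r2 [th thI <-]].
  by split => //; [rewrite lt_eqF|exact: sub].
split; last split.
- split; split; last 2 first.
  + apply: (@zero_density_ge _ _ _ _ 5) => e e0; have [N1 NP] := slow' e e0.
    exists (maxn N0 N1) => n; rewrite geq_max => /andP[/both /andP[ts fs] /NP sl].
    have [rs [rl rsP]] := left_arc_zeros ts fs sl; rewrite size_mkseq => /le_trans; apply.
    rewrite ler_nat wE; apply: nzeros_root_list => // r /rsP[r1 r2 rL].
    by split => //; [rewrite gt_eqF|exact: subset_closure].
  + by rewrite divr_gt0 //; lra.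
  + apply: (@zero_density_ge _ _ _ _ 7) => e e0.
    (* The right arc is shortened by f pi / 2 at each end, at the cost of a
       density f / 2. *)
    pose f := Num.min (e / 2) 1; have f0 : 0 < f by rewrite lt_min divr_gt0 ?ltr01.
    have [f1 f2] : f <= e / 2 /\ f <= 1 by rewrite !ge_min !lexx orbT.
    have [N1 NP] := slow' f f0.
    exists (maxn N0 N1) => n; rewrite geq_max => /andP[/both /andP[ts fs] /NP sl].
    have [rs [rl rsP rss]] := left_arc_zeros ts fs sl.
    pose x := 2 * pi / 3 - f * pi / 2.
    have x1 : - (2 * pi / 3) < - x by rewrite /x; nra.
    have x2 : - x < x by rewrite /x; nra.
    have x3 : x < 2 * pi / 3 by rewrite /x; nra.
    have [qs [ql qsP qss]] := right_arc_zeros ts fs x1 x2 x3.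
    apply: (@le_trans _ _ (size (rs ++ qs))%:R); last first.
      rewrite ler_nat wE; apply: nzeros_root_list => //.
        by apply: root_list_cat => // r /rsP[_ r3 _] /qsP[_ r3' _]; lra.
      move=> r; rewrite mem_cat => /orP[/rsP[r1 r2 _]|/qsP[r1 r2 _]].
        by split; rewrite ?gt_eqF //; exact: circle_point_S1.
      by split; rewrite ?lt_eqF //; exact: circle_point_S1.
    rewrite size_cat natrD; move: rss qss; rewrite size_mkseq /left_density.
    have -> : (x - - x) / (2 * pi) = 2 / 3 - f / 2.
      by rewrite /x; move: (pi : R) p0 => z z0; field; rewrite gt_eqF.
    have : 0 <= n%:R :> R by []. 
    by nra.
  + by lra.
- move=> theta1 theta2 t1 t12 t2; apply: (@zero_density_ge _ _ _ _ 2) => e e0.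
  exists N0 => n /arc H; apply: le_trans (H _ theta1 theta2 _ t12 t2 _); last first.
  + by move=> th thI; exists th => //=; rewrite in_itv.
  + by lra.
  + by rewrite lerD2r ler_wpM2l // lerBlDr lerDl ltW.
- apply: (@zero_density_ge _ _ _ _ 2) => e e0.
  pose f := Num.min e 1; have f0 : 0 < f by rewrite lt_min e0 ltr01.
  have [f1 f2] : f <= e /\ f <= 1 by rewrite !ge_min !lexx orbT.
  pose x := 2 * pi / 3 - f * pi / 2.
  have x1 : - (2 * pi / 3) < - x by rewrite /x; nra.
  have x2 : - x < x by rewrite /x; nra.
  have x3 : x < 2 * pi / 3 by rewrite /x; nra.
  exists N0 => n /arc H; apply: le_trans (H _ _ _ x1 x2 x3 _); last first.
    move=> th /andP[th1 th2]; exists th => //=.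
    by rewrite ltr_norml; apply/andP; split; lra.
  have -> : (x - - x) / (2 * pi) = 2 / 3 - f / 2.
    by rewrite /x; move: (pi : R) p0 => z z0; field; rewrite gt_eqF.
  by rewrite lerD2r ler_wpM2l //; lra.
Qed.
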